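(* Let $\rho>0$ and let $C\subset \mathbb{S}^2_\rho=\{x\in\mathbb{R}^3:\|x\|=\rho\}$ be a smooth closed geodesic curve of total intrinsic length $L$ (e.g. a great circle or a small circle), and let $P$ be the uniform probability measure on $C$ with respect to arc-length. Then the intrinsic quantization problem on $(C,d_G)$ with squared geodesic distortion is equivalent to the classical one-dimensional uniform quantization problem on a circle of length $L$. In particular, for each $n\ge 1$, the optimal set of $n$-means consists of $n$ equally spaced points along $C$, each Voronoi region has length $L/n$, each codepoint is the geodesic midpoint of its cell (its Voronoi region), and the quantization error satisfies $$V_n=\frac{L^2}{12n^2}.$$
   Context: $d_G$ denotes the geodesic (intrinsic) distance on the underlying manifold; here that manifold is the curve $C$ with the one-dimensional Riemannian structure given by arc-length. Quantization: for a metric space $(M,d)$ and a Borel probability measure $P$ on $M$, the distortion of a finite set (codebook) $\alpha\subset M$ is $V(\alpha;P)=\int_M\min_{a\in\alpha}d(x,a)^2\,dP(x)$, and the $n$th quantization error is $V_n=V_n(P)=\inf_{|\alpha|\le n}V(\alpha;P)$. A codebook $\alpha$ with $|\alpha|\le n$ attaining this infimum is called an optimal set of $n$-means, and its elements are called codepoints. The Voronoi region of $a\in\alpha$ is $\{x\in M: d(x,a)\le d(x,b)\text{ for all }b\in\alpha\}$. Here $M=C$ and $d=d_G$ (squared geodesic distortion). The classical one-dimensional uniform quantization problem on a circle of length $L$ is the same problem with $M$ a circle of length $L$, $d$ its arc-length distance, and $P$ the uniform probability measure on it. *)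

(* Defs.v *)
From HB Require Import structures.
From mathcomp Require Import all_boot all_order all_algebra.
From mathcomp Require Import all_classical all_reals all_analysis.

Set Implicit Arguments.
Unset Strict Implicit.
Unset Printing Implicit Defensive.

Import Order.TTheory GRing.Theory Num.Theory.
Import numFieldNormedType.Exports.

Local Open Scope classical_set_scope.
Local Open Scope card_scope.
Local Open Scope ring_scope.

(* The library norm of 'rV[R]_N is the sup norm (it induces the same topology),
   so the Euclidean norm is introduced separately. *)
Definition enorm (R : realType) (N : nat) (x : 'rV[R]_N) : R :=
  Num.sqrt (\sum_(i < N) x ord0 i ^+ 2).

Definition esphere (R : realType) (N : nat) (r : R) : set 'rV[R]_N :=
  [set x | enorm x = r].

(* R^N with its Borel sigma-algebra. *)
Definition borel_rV (R : realType) (N : nat) :=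
  g_sigma_algebraType (@open 'rV[R]_N).

(* [itv_partition 0 1 s] says that 0 :: s is increasing from 0 to 1. *)
Definition polygon_length (R : realType) (N : nat) (sigma : R -> 'rV[R]_N)
    (s : seq R) : R :=
  \sum_(0 <= k < size s)
    enorm (sigma (nth 0 (0 :: s) k.+1) - sigma (nth 0 (0 :: s) k)).

Definition path_length (R : realType) (N : nat) (sigma : R -> 'rV[R]_N)
    : \bar R :=
  ereal_sup [set (polygon_length sigma s)%:E | s in itv_partition 0 1].

Definition path_in (R : realType) (N : nat) (C : set 'rV[R]_N)
    (x y : 'rV[R]_N) : set (R -> 'rV[R]_N) :=
  [set sigma : R -> 'rV[R]_N | [/\ {within `[(0:R), 1], continuous sigma},
                   sigma 0 = x, sigma 1 = y &
                   sigma @` `[(0:R), 1] `<=` C]].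

(* Only meaningful when x and y are joined by a rectifiable path in C, which is
   the case for any two points of a closed curve; [fine +oo] is 0. *)
Definition geodesic_dist (R : realType) (N : nat) (C : set 'rV[R]_N)
    (x y : 'rV[R]_N) : R :=
  fine (ereal_inf [set path_length sigma | sigma in path_in C x y]).

(* C is a smooth simple closed curve of length L, traversed once by gamma at
   unit speed over one period. *)
Record arclength_param (R : realType) (N : nat) (C : set 'rV[R]_N) (L : R)
    (gamma : R -> 'rV[R]_N) : Prop := ArclengthParam {
  alp_range : C = range gamma;
  alp_smooth : forall (k : nat) (s : R), derivable (derive1n k gamma) s 1;
  alp_unit_speed : forall s : R, enorm (derive1 gamma s) = 1;
  alp_periodic : forall s : R, gamma (s + L) = gamma s;
  alp_simple : forall s t : R, gamma s = gamma t ->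
    exists k : int, s - t = k%:~R * L
}.

Definition arc_length (R : realType) (N : nat) (L : R)
    (gamma : R -> 'rV[R]_N) (A : set 'rV[R]_N) : \bar R :=
  lebesgue_measure (`[0, L[ `&` gamma @^-1` A).

Definition uniform_on_curve (R : realType) (N : nat) (L : R) (hL : 0 < L)
    (gamma : R -> borel_rV R N) (P : probability (borel_rV R N) R) : Prop :=
  forall A : set (borel_rV R N), measurable A ->
    P A = pushforward (uniform_prob hL) gamma A.

Definition round_circle (R : realType) (L : R) : set 'rV[R]_2 :=
  esphere (L / (2 * pi)).

Definition round_circle_param (R : realType) (L : R) (s : R) : 'rV[R]_2 :=
  let r := L / (2 * pi) in
  \row_(i < 2) (if i == ord0 then r * cos (s / r) else r * sin (s / r)).

(* Quantization on M `<=` T.  The codebook set0 has distortion +oo. *)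
Definition distortion (d : measure_display) (T : measurableType d)
    (R : realType) (P : probability T R) (M : set T) (dist : T -> T -> R)
    (alpha : set T) : \bar R :=
  (\int[P]_(x in M) ereal_inf [set (dist x a ^+ 2)%R%:E | a in alpha])%E.

Definition codebook (T : Type) (M : set T) (n : nat) : set (set T) :=
  [set alpha | alpha `<=` M /\ alpha #<= `I_n].

Definition quantization_error (d : measure_display) (T : measurableType d)
    (R : realType) (P : probability T R) (M : set T) (dist : T -> T -> R)
    (n : nat) : \bar R :=
  ereal_inf [set distortion P M dist alpha | alpha in codebook M n].

Definition optimal_n_means (d : measure_display) (T : measurableType d)
    (R : realType) (P : probability T R) (M : set T) (dist : T -> T -> R)
    (n : nat) (alpha : set T) : Prop :=
  codebook M n alpha /\
  distortion P M dist alpha = quantization_error P M dist n.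

Definition voronoi_region (T : Type) (R : realType) (M : set T)
    (dist : T -> T -> R) (alpha : set T) (a : T) : set T :=
  [set x | M x /\ forall b, alpha b -> dist x a <= dist x b].

(* The two problems are identified by a measure-preserving bijective isometry,
   under which codebooks, distortions, optimal sets and errors correspond. *)
Definition quantization_equivalent (d1 d2 : measure_display)
    (T1 : measurableType d1) (T2 : measurableType d2) (R : realType)
    (P1 : probability T1 R) (M1 : set T1) (dist1 : T1 -> T1 -> R)
    (P2 : probability T2 R) (M2 : set T2) (dist2 : T2 -> T2 -> R) : Prop :=
  exists phi : T1 -> T2,
    [/\ set_bij M1 M2 phi,
        (forall x y, M1 x -> M1 y -> dist2 (phi x) (phi y) = dist1 x y),
        measurable_fun M1 phi /\
          (forall B : set T2, measurable B -> P2 B = P1 (M1 `&` phi @^-1` B)),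
        (forall alpha : set T1, alpha `<=` M1 -> finite_set alpha ->
           distortion P2 M2 dist2 (phi @` alpha)
           = distortion P1 M1 dist1 alpha) &
        forall n : nat,
          quantization_error P2 M2 dist2 n = quantization_error P1 M1 dist1 n /\
          (forall alpha : set T1, alpha `<=` M1 ->
             (optimal_n_means P2 M2 dist2 n (phi @` alpha) <->
              optimal_n_means P1 M1 dist1 n alpha))].

Definition equally_spaced (R : realType) (N : nat) (L : R)
    (gamma : R -> 'rV[R]_N) (n : nat) (alpha : set 'rV[R]_N) : Prop :=
  alpha #= `I_n /\
  exists s0 : R, alpha = [set gamma (s0 + k%:R * (L / n%:R)) | k in `I_n].

(* V is an arc of the curve, a bisects it, and a is at geodesic distance half
   the length of the arc from both ends.  When V is the whole closed curve the
   two ends are the same point. *)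
Definition geodesic_midpoint (R : realType) (N : nat)
    (dist : 'rV[R]_N -> 'rV[R]_N -> R) (gamma : R -> 'rV[R]_N)
    (V : set 'rV[R]_N) (a : 'rV[R]_N) : Prop :=
  exists u v : R,
    [/\ u <= v, V = gamma @` `[u, v], a = gamma ((u + v) / 2),
        dist a (gamma u) = (v - u) / 2 & dist a (gamma v) = (v - u) / 2].

(* Main.v *)
(* Write r = L / (2 n). On a unit-speed simple loop the geodesic distance of
   gamma s and gamma t is the distance of s - t to the lattice of multiples of L,
   because short chords are almost as long as the arcs they subtend. Hence every
   codebook has the distortion of its parameters on the circle of length L, and all
   closed curves of length L give the same quantization problem.
   On the circle let D be the squared distance to a nonempty codebook with at most
   n points a. Then D >= r^2 - sum_a max(0, r^2 - d(., a)^2) pointwise, and each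
   summand has integral 4/3 r^3, so the integral of D over the circle is at least
   L r^2 - n 4/3 r^3 = L^3 / (12 n^2). In the case of equality there are n points
   and the inequality is an equality everywhere, by continuity; it says that the
   arcs of half-length r around the codepoints tile the circle. In such a tiling
   a + 2 r is a codepoint whenever a is, so the codepoints are equally spaced. *)
Require Import Defs.
From mathcomp Require Import all_boot all_order all_algebra.
From mathcomp Require Import all_classical all_reals all_analysis.
From mathcomp Require Import measurable_realfun zify ring lra.
Import Order.TTheory GRing.Theory Num.Theory.
Import numFieldNormedType.Exports.
Local Open Scope classical_set_scope.
Local Open Scope card_scope.
Local Open Scope ring_scope.

Set Implicit Arguments.
Unset Strict Implicit.
Unset Printing Implicit Defensive.

(** * Circular distance and Euclidean norm *)

Lemma periodicz (R : realType) (V : Type) (f : R -> V) (T : R) :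
  (forall u, f (u + T) = f u) -> forall (k : int) u, f (u + k%:~R * T) = f u.
Proof.
move=> hf; have h n t : f (t + n%:R * T) = f t.
  elim: n => [|n IH]; first by rewrite mul0r addr0.
  by rewrite -natr1 mulrDl mul1r addrA hf.
case=> n u; first exact: h.
by rewrite NegzE intrN mulNr -[in RHS](subrK (n.+1%:R * T) u) h.
Qed.

(* The distance from x to the lattice of integer multiples of L; the floor makes
   the minimum over the lattice a minimum of two terms. *)
Definition circle_dist (R : realType) (L x : R) : R :=
  let f := x - L * (Num.floor (x / L))%:~R in Num.min f (L - f).

Section CircleDist.
Variables (R : realType) (L : R).
Hypothesis hL : 0 < L.
Local Notation circ := (circle_dist L).
Implicit Types (x y : R) (k : int).

Lemma circle_dist_attained x : exists k : int, circ x = `|x - k%:~R * L|.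
Proof.
rewrite /circle_dist; set m := Num.floor (x / L).
have h1 : m%:~R * L <= x by rewrite -ler_pdivlMr//; exact: floor_le_tmp.
have h2 : x < (m + 1)%:~R * L.
  by rewrite -ltr_pdivrMr//; exact: floorD1_gt.
rewrite intrD mulrDl mul1r in h2.
rewrite minEle; case: ifP => _.
  by exists m; rewrite ger0_norm ?subr_ge0//; ring.
exists (m + 1); rewrite intrD mulrDl mul1r ler0_norm; first by ring.
by lra.
Qed.

(** With [m] the floor of [x / L], the point [x] lies between [m L] and [(m + 1) L]. Multiples with
    [k <= m] are no closer than the first, all others no closer than the second. *)
Lemma circle_dist_le x k : circ x <= `|x - k%:~R * L|.
Proof.
rewrite /circle_dist; set m := Num.floor (x / L).
have h1 : m%:~R * L <= x by rewrite -ler_pdivlMr//; exact: floor_le_tmp.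
have h2 : x < (m + 1)%:~R * L.
  by rewrite -ltr_pdivrMr//; exact: floorD1_gt.
rewrite intrD mulrDl mul1r in h2.
rewrite ge_min; have [km|mk] := leP k m.
  apply/orP; left; have : (k%:~R : R) * L <= m%:~R * L.
    by rewrite ler_pM2r// ler_int.
  by move=> h; rewrite ger0_norm; lra.
apply/orP; right; have : ((m + 1)%:~R : R) * L <= k%:~R * L.
  by rewrite ler_pM2r// ler_int lezD1.
by rewrite intrD mulrDl mul1r => h; rewrite ler0_norm; lra.
Qed.

Lemma circle_dist_le_norm x : circ x <= `|x|.
Proof. by have := circle_dist_le x 0; rewrite mul0r subr0. Qed.

Lemma circle_dist_ge0 x : 0 <= circ x.
Proof. by have [k ->] := circle_dist_attained x. Qed.

Lemma circle_dist0 : circ 0 = 0.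
Proof.
apply/eqP; rewrite eq_le circle_dist_ge0 andbT.
by have := circle_dist_le_norm 0; rewrite normr0.
Qed.

Lemma circle_distD x y : circ (x + y) <= circ x + circ y.
Proof.
have [k ->] := circle_dist_attained x; have [l ->] := circle_dist_attained y.
apply: le_trans (ler_normD _ _).
apply: le_trans (circle_dist_le _ (k + l)) _.
by rewrite intrD mulrDl le_eqVlt; apply/orP; left; apply/eqP; congr `|_|; ring.
Qed.

Lemma circle_distN x : circ (- x) = circ x.
Proof.
have h y : circ (- y) <= circ y.
  have [k ->] := circle_dist_attained y.
  apply: le_trans (circle_dist_le _ (- k)) _.
  by rewrite intrN mulNr opprK -normrN opprD opprK.
by apply/eqP; rewrite eq_le h /= -{1}[x]opprK h.
Qed.

Lemma circle_distC x y : circ (x - y) = circ (y - x).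
Proof. by rewrite -circle_distN opprB. Qed.

Lemma circle_dist_triangle y x z : circ (x - z) <= circ (x - y) + circ (y - z).
Proof. by apply: le_trans (circle_distD _ _); rewrite addrA subrK. Qed.

Lemma circle_distDz x k : circ (x + k%:~R * L) = circ x.
Proof.
have h y l : circ (y + l%:~R * L) <= circ y.
  have [m ->] := circle_dist_attained y.
  apply: le_trans (circle_dist_le _ (m + l)) _.
  by rewrite intrD mulrDl opprD addrACA subrr addr0.
apply/eqP; rewrite eq_le h /=.
by rewrite -{1}[x](addrK (k%:~R * L)) -mulNr -intrN h.
Qed.

(** A nonzero multiple of [L] has absolute value at least [L], hence distance at least [L / 2] from
    [x], and 0 is no farther than that. *)
Lemma circle_dist_small x : `|x| <= L / 2 -> circ x = `|x|.
Proof.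
move=> hx; apply/eqP; rewrite eq_le circle_dist_le_norm /=.
have [k ->] := circle_dist_attained x.
have [->|k0] := eqVneq k 0; first by rewrite mul0r subr0.
have : L <= `|k%:~R * L|.
  rewrite normrM (gtr0_norm hL) ler_peMl ?(ltW hL)//.
  by rewrite -intr_norm -[1]/(1%:~R) ler_int -gtz0_ge1 normr_gt0.
have := lerB_dist (k%:~R * L) x; rewrite distrC; lra.
Qed.

Lemma circle_dist_le_half x : circ x <= L / 2.
Proof.
rewrite /circle_dist; set f := x - _; rewrite ge_min.
by case: (leP f (L / 2)) => //= h; lra.
Qed.

Lemma circle_dist_eq0 x : circ x = 0 -> exists k : int, x = k%:~R * L.
Proof.
have [k ->] := circle_dist_attained x => /eqP; rewrite normr_eq0 subr_eq0.
by move=> /eqP ->; exists k.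
Qed.

(** Subadditivity and [circ x <= |x|] make [circ] 1-Lipschitz. *)
Lemma circle_dist_continuous : continuous circ.
Proof.
move=> x; apply/cvgrPdist_le => e e0; near=> y.
have h : circ x - circ y <= `|x - y|.
  have := circle_distD (x - y) y; rewrite subrK => h.
  by have := circle_dist_le_norm (x - y); lra.
have h' : circ y - circ x <= `|x - y|.
  have := circle_distD (y - x) x; rewrite subrK => h'.
  by have := circle_dist_le_norm (y - x); rewrite (distrC y); lra.
have : `|x - y| <= e.
  near: y; apply: (@cvgr_dist_le _ R) => //; exact: cvg_id.
move=> hxy; rewrite ler_norml; apply/andP; split.
  by rewrite lerNl opprB (le_trans h').
exact: le_trans h hxy.
Unshelve. all: by end_near. Qed.

End CircleDist.

Section Euclid.
Variables (R : realType) (N : nat).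
Implicit Types x y : 'rV[R]_N.

Definition edot x y : R := \sum_(i < N) x ord0 i * y ord0 i.

Lemma edotBl x y z : edot (x - y) z = edot x z - edot y z.
Proof. by rewrite -sumrB; apply: eq_bigr => i _; rewrite !mxE; ring. Qed.

Lemma enorm_ge0 x : 0 <= enorm x.
Proof. exact: sqrtr_ge0. Qed.

Lemma enorm_sqr x : enorm x ^+ 2 = edot x x.
Proof.
by rewrite sqr_sqrtr; [apply: eq_bigr => i _|apply: sumr_ge0 => i _; exact: sqr_ge0].
Qed.

Lemma enorm0 : enorm (0 : 'rV[R]_N) = 0.
Proof.
rewrite /enorm big1 ?sqrtr0// => i _.
by rewrite mxE expr0n.
Qed.

Lemma enorm_eq0 x : enorm x = 0 -> x = 0.
Proof.
move=> h; have : edot x x = 0 by rewrite -enorm_sqr h expr0n.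
move=> /psumr_eq0P h'; apply/rowP => i; rewrite mxE.
by apply/eqP; rewrite -sqrf_eq0 expr2 h'// => j _; rewrite -expr2 sqr_ge0.
Qed.

Lemma enormN x : enorm (- x) = enorm x.
Proof. by congr Num.sqrt; apply: eq_bigr => i _; rewrite mxE sqrrN. Qed.

(** Cauchy-Schwarz: with [a], [b] the norms of [x], [y], the squared norm of [b x - a y] expands to
    [2 a b (a b - edot x y)]. *)
Lemma edot_le x y : edot x y <= enorm x * enorm y.
Proof.
have [->|x0] := eqVneq x 0.
  by rewrite enorm0 mul0r /edot big1// => i _; rewrite mxE mul0r.
have [->|y0] := eqVneq y 0.
  by rewrite enorm0 mulr0 /edot big1// => i _; rewrite mxE mulr0.
set a := enorm x; set b := enorm y.
have a0 : 0 < a.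
  by rewrite lt_neqAle enorm_ge0 andbT eq_sym; apply: contra_neq x0 => /enorm_eq0.
have b0 : 0 < b.
  by rewrite lt_neqAle enorm_ge0 andbT eq_sym; apply: contra_neq y0 => /enorm_eq0.
have h : 0 <= \sum_(i < N) (b * x ord0 i - a * y ord0 i) ^+ 2.
  by apply: sumr_ge0 => i _; exact: sqr_ge0.
have e : \sum_(i < N) (b * x ord0 i - a * y ord0 i) ^+ 2 =
    b ^+ 2 * edot x x - 2 * a * b * edot x y + a ^+ 2 * edot y y.
  rewrite /edot !mulr_sumr -sumrB -big_split/=; apply: eq_bigr => i _; ring.
rewrite e -!enorm_sqr -/a -/b in h.
have : 0 <= (2 * a * b) * (a * b - edot x y) by lra.
by rewrite pmulr_rge0 ?subr_ge0// !mulr_gt0.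
Qed.

Lemma coord_le_norm x i : `|x ord0 i| <= `|x|.
Proof.
rewrite [leRHS]/Num.Def.normr/= mx_normrE.
exact: (le_bigmax _ (fun ij : 'I_1 * 'I_N => `|x ij.1 ij.2|) (ord0, i)).
Qed.

(** Turns uniform continuity, which is phrased in the sup norm, into a bound on Euclidean chords. *)
Lemma enorm_le_norm x : enorm x <= N%:R * `|x|.
Proof.
rewrite -[leRHS]ger0_norm ?mulr_ge0// -sqrtr_sqr ler_wsqrtr//.
have [N0|] := posnP N.
  by rewrite big1 ?sqr_ge0// => i; have := ltn_ord i; rewrite {2}N0.
move=> N0; apply: (@le_trans _ _ (\sum_(i < N) `|x| ^+ 2)).
  apply: ler_sum => i _.
  by rewrite -real_normK ?num_real// lerXn2r ?nnegrE// coord_le_norm.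
rewrite sumr_const card_ord -[leLHS]mulr_natl exprMn ler_wpM2r ?sqr_ge0//.
by rewrite expr2 ler_peMl// ler1n.
Qed.

Lemma cvg_edot (T : Type) (F : set_system T) {FF : Filter F}
    (f g : T -> 'rV[R]_N) x y :
  f @ F --> x -> g @ F --> y -> edot (f t) (g t) @[t --> F] --> edot x y.
Proof.
move=> fx gy; rewrite /edot; apply: cvg_big => [|i _].
  by move=> z; exact: add_continuous.
apply: cvgM.
  exact: (@cvg_comp _ _ _ f (fun M : 'rV[R]_N => M ord0 i) _ _ _ fx
    (@coord_continuous R 1 N ord0 i x)).
exact: (@cvg_comp _ _ _ g (fun M : 'rV[R]_N => M ord0 i) _ _ _ gy
    (@coord_continuous R 1 N ord0 i y)).
Qed.

End Euclid.

(** * Chords of closed curves *)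

(* The part of [arclength_param] that is used, weakened from smooth to C^1 so
   that the round circle qualifies after a single differentiation. *)
Record unit_speed_loop (R : realType) (N : nat) (C : set 'rV[R]_N) (L : R)
    (gamma : R -> 'rV[R]_N) : Prop := UnitSpeedLoop {
  usl_range : C = range gamma;
  usl_derivable : forall s : R, derivable gamma s 1;
  usl_C1 : continuous (derive1 gamma);
  usl_speed : forall s : R, enorm (derive1 gamma s) = 1;
  usl_periodic : forall s : R, gamma (s + L) = gamma s;
  usl_simple : forall s t : R, gamma s = gamma t ->
    exists k : int, s - t = k%:~R * L
}.

Lemma arclength_param_loop (R : realType) (N : nat) (C : set 'rV[R]_N) (L : R)
    (gamma : R -> 'rV[R]_N) :
  arclength_param C L gamma -> unit_speed_loop C L gamma.
Proof.
case=> ? hs ? ? ?; split=> //; first exact: (hs 0%N).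
move=> s; apply/differentiable_continuous/derivable1_diffP.
exact: (hs 1%N).
Qed.

Lemma floor_reduction (R : realType) (L s : R) : 0 < L ->
  exists2 k : int, 0 <= s - k%:~R * L & s - k%:~R * L < L.
Proof.
move=> hL; exists (Num.floor (s / L)).
  by rewrite subr_ge0 -ler_pdivlMr//; exact: floor_le_tmp.
have : s < (Num.floor (s / L) + 1)%:~R * L.
  by rewrite -ltr_pdivrMr//; exact: floorD1_gt.
by rewrite intrD mulrDl mul1r; lra.
Qed.

Section Loop.
Variables (R : realType) (N : nat) (C : set 'rV[R]_N) (L : R).
Variables (gamma : R -> 'rV[R]_N).
Hypotheses (hL : 0 < L) (hg : unit_speed_loop C L gamma).
Local Notation circ := (circle_dist L).

Lemma loopDz s (k : int) : gamma (s + k%:~R * L) = gamma s.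
Proof. exact: (periodicz (usl_periodic hg)). Qed.

Lemma loop_eqP s t : gamma s = gamma t <-> circ (s - t) = 0.
Proof.
split=> [/(usl_simple hg)[k ->]|/(circle_dist_eq0 hL)[k h]].
  by rewrite -[_ * L]add0r circle_distDz// circle_dist0.
by rewrite -(subrK t s) h addrC loopDz.
Qed.

Lemma loop_continuous : continuous gamma.
Proof.
move=> s; apply/differentiable_continuous/derivable1_diffP.
exact: (usl_derivable hg).
Qed.

Lemma is_derive_edot_loop (w : 'rV[R]_N) (s : R) :
  is_derive s (1 : R) (fun u => edot (gamma u) w) (edot (derive1 gamma s) w).
Proof.
have dg : derivable gamma s 1 by exact: (usl_derivable hg).
rewrite (_ : (fun u => _) =
    \sum_(i < N) (fun u => gamma u ord0 i * w ord0 i)); last first.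
  by apply/funext => u; rewrite fct_sumE.
apply: (@is_derive_sum _ _ _ N (fun i u => gamma u ord0 i * w ord0 i)) => i.
have di : is_derive s 1 (fun u => gamma u ord0 i) (derive1 gamma s ord0 i).
  split; first exact: (derivable_mxP gamma s 1).1.
  by rewrite derive1E derive_mx// mxE.
rewrite (_ : (fun u => _) = w ord0 i \*: (fun u => gamma u ord0 i)); last first.
  by apply/funext => u; rewrite mulrC.
by rewrite mulrC; exact: is_deriveZ.
Qed.

(** The mean value theorem has no equality form for vector-valued maps, so it is applied to the
    component along a fixed [w]. *)
Lemma loop_MVT w s t : s <= t ->
  exists2 c, s <= c <= t &
    edot (gamma t - gamma s) w = edot (derive1 gamma c) w * (t - s).
Proof.
move=> st.
have [||c hc e] := @MVT_segment R (fun u => edot (gamma u) w)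
  (fun u => edot (derive1 gamma u) w) s t st.
- by move=> x _; exact: is_derive_edot_loop.
- apply: continuous_subspaceT => x.
  apply/differentiable_continuous/derivable1_diffP.
  by have [] := is_derive_edot_loop w x.
- by exists c; [move: hc; rewrite in_itv|rewrite edotBl].
Qed.

(** Taking [w] to be the chord [v] itself, the mean value theorem, Cauchy-Schwarz and unit speed
    give [enorm v ^+ 2 <= enorm v * (t - s)]. *)
Lemma loop_chord_le s t : enorm (gamma t - gamma s) <= `|t - s|.
Proof.
wlog st : s t / s <= t => [hw|].
  have [|/ltW] := leP s t; first exact: hw.
  by move=> /hw; rewrite -enormN opprB distrC.
set v := gamma t - gamma s.
have [c _ e] := loop_MVT v st.
have := edot_le (derive1 gamma c) v; rewrite (usl_speed hg) mul1r => h.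
have : enorm v ^+ 2 <= enorm v * (t - s).
  by rewrite enorm_sqr e ler_wpM2r// subr_ge0.
rewrite ger0_norm ?subr_ge0// expr2.
have := enorm_ge0 v; rewrite le_eqVlt => /predU1P[<- _|v0].
  by rewrite subr_ge0.
by rewrite ler_pM2l.
Qed.

(* MVT for the component of gamma along gamma'(s); the scalar product of the
   velocities at s and s + h exceeds c for small h, uniformly in s by compactness. *)
Lemma loop_chord_ge_local c : c < 1 -> exists2 eta, 0 < eta &
  forall s h, 0 <= h <= eta -> c * h <= enorm (gamma (s + h) - gamma s).
Proof.
move=> c1.
have : \forall h \near 0, `[0, L] `<=`
    [set s | c < edot (derive1 gamma (s + h)) (derive1 gamma s)].
  have /compact_near_coveringP cK := @segment_compact R 0 L.
  apply: (cK R (nbhs (0 : R))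
    (fun h s => c < edot (derive1 gamma (s + h)) (derive1 gamma s))).
  move=> s _.
  (* The limit is the squared speed at [s], which is 1 and exceeds [c]. *)
  suff : edot (derive1 gamma (p.1 + p.2)) (derive1 gamma p.1)
      @[p --> (nbhs s, nbhs (0 : R))] --> edot (derive1 gamma s) (derive1 gamma s).
    move/(cvgr_gt _); apply.
    by rewrite -enorm_sqr (usl_speed hg) expr1n.
  apply: cvg_edot.
    apply: (@cvg_comp _ _ _ (fun p : R * R => p.1 + p.2) (derive1 gamma) _ (nbhs s)).
      have : p.1 + p.2 @[p --> (nbhs s, nbhs (0 : R))] --> s + 0.
        by apply: cvgD; [exact: cvg_fst|exact: cvg_snd].
      by rewrite addr0.
    exact: (usl_C1 hg).
  apply: (@cvg_comp _ _ _ fst (derive1 gamma) _ (nbhs s)); first exact: cvg_fst.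
  exact: (usl_C1 hg).
move=> /nbhs_ballP[e /= e0 he]; exists (e / 2); first by rewrite divr_gt0.
move=> s h /andP[h0 hh].
(* Periodicity brings [s] into the compact period on which the estimate is uniform. *)
wlog hs : s / 0 <= s <= L => [hw|].
  have [k k0 kL] := floor_reduction s hL.
  have := hw (s - k%:~R * L); rewrite -mulNr -intrN addrAC !loopDz.
  by apply; rewrite intrN mulNr k0 ltW.
have sh : s <= s + h by rewrite lerDl.
have [d /andP[sd dh] ed] := loop_MVT (derive1 gamma s) sh.
have := edot_le (gamma (s + h) - gamma s) (derive1 gamma s).
rewrite (usl_speed hg) mulr1 ed [s + h]addrC addrK; apply: le_trans.
rewrite ler_wpM2r//.
have /he : ball 0 e (d - s).
  by rewrite /ball/= sub0r normrN ger0_norm; lra.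
move=> /(_ s); rewrite /= in_itv/= => /(_ hs).
by rewrite addrC subrK => /ltW.
Qed.

(** For offsets between [eta] and [L - eta] no chord vanishes, because [gamma] is injective modulo
    [L]. Compactness then bounds all these chords below, so a shorter chord has parameters close
    modulo [L]. *)
Lemma loop_separation eta : 0 < eta -> exists2 d, 0 < d &
  forall s t, enorm (gamma s - gamma t) < d -> circ (s - t) < eta.
Proof.
move=> eta0.
have : \forall d \near 0, `[0, L] `*` `[eta, L - eta] `<=` [set p : R * R |
    d < edot (gamma (p.1 + p.2) - gamma p.1) (gamma (p.1 + p.2) - gamma p.1)].
  have /compact_near_coveringP cK := compact_setX (@segment_compact R 0 L)
    (@segment_compact R eta (L - eta)).
  apply: (cK R (nbhs (0 : R)) (fun d p =>
    d < edot (gamma (p.1 + p.2) - gamma p.1) (gamma (p.1 + p.2) - gamma p.1))).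
  move=> [s h] [_ /=]; rewrite in_itv/= => /andP[h1 h2].
  set f := fun p : R * R => gamma (p.1 + p.2) - gamma p.1.
  have cf : f p @[p --> nbhs (s, h)] --> f (s, h).
    apply: cvgB.
      apply: (@cvg_comp _ _ _ (fun p : R * R => p.1 + p.2) gamma _ (nbhs (s + h))).
        by apply: cvgD; [exact: cvg_fst|exact: cvg_snd].
      exact: loop_continuous.
    apply: (@cvg_comp _ _ _ fst gamma _ (nbhs s)); first exact: cvg_fst.
    exact: loop_continuous.
  have : edot (f q.1) (f q.1) - q.2 @[q --> (nbhs (s, h), nbhs (0 : R))] -->
      edot (f (s, h)) (f (s, h)) - 0.
    apply: cvgB; last exact: cvg_snd.
    by apply: cvg_edot; apply: (cvg_comp fst f _ cf); exact: cvg_fst.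
  rewrite subr0 => /(cvgr_gt _)/(_ 0) H.
  have : 0 < edot (f (s, h)) (f (s, h)).
    rewrite -enorm_sqr exprn_gt0// lt_neqAle enorm_ge0 andbT eq_sym.
    apply/eqP => /enorm_eq0/eqP; rewrite subr_eq0 => /eqP /(usl_simple hg)[k].
    rewrite /= addrC addKr => hk.
    have : 0 < (k%:~R : R) * L < 1 * L by rewrite -hk mul1r; lra.
    rewrite pmulr_lgt0// ltr_pM2r// ltr0z ltrz1.
    by move=> /andP[]; case: k {hk} => // -[].
  move=> /H; apply: filterS => -[p d] /=.
  by rewrite subr_gt0.
move=> /nbhs_ballP[e /= e0 he].
(* Compactness bounds the squared chord by [e / 2]; the cap at 1 ensures that a chord shorter than
   [d] has a square no larger than itself. *)
set d := Num.min (e / 2) 1; have d0 : 0 < d by rewrite lt_min ltr01 divr_gt0.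
exists d => // s t hst; rewrite ltNge; apply/negP => hc.
have [k k0 kL] := floor_reduction t hL.
have [m m0 mL] := floor_reduction (s - t) hL.
set t0 := t - k%:~R * L; set h := s - t - m%:~R * L.
have hh : circ (s - t) = circ h by rewrite /h -mulNr -intrN circle_distDz.
have /he : ball 0 e (e / 2) by rewrite /ball/= sub0r normrN gtr0_norm; lra.
move=> /(_ (t0, h)); rewrite /= !in_itv/=.
have -> : gamma t0 = gamma t by rewrite /t0 -mulNr -intrN loopDz.
have -> : gamma (t0 + h) = gamma s.
  rewrite -[RHS](loopDz _ (- (k + m))) /t0 /h; congr gamma.
  by rewrite intrN intrD; ring.
rewrite -enorm_sqr => H.
have : e / 2 < enorm (gamma s - gamma t) ^+ 2.
  apply: H; split; first by rewrite k0 ltW.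
  have := circle_dist_le_norm hL h; rewrite ger0_norm// -hh => h1.
  have h2 : circ (s - t) <= L - h.
    have hL1 : h <= L by exact: ltW.
    by have := circle_dist_le hL h 1; rewrite mul1r distrC ger0_norm ?subr_ge0// -hh.
  by apply/andP; split; lra.
move: hst; rewrite lt_min => /andP[h1 h2].
apply/negP; rewrite -leNgt (le_trans _ (ltW h1))// expr2 ler_piMl ?enorm_ge0//.
exact: ltW.
Qed.

(** A short chord forces the parameters to be close modulo [L] by [loop_separation], and there the
    local bound applies. *)
Lemma loop_chord_ge c : 0 <= c < 1 -> exists2 d, 0 < d &
  forall s t, enorm (gamma s - gamma t) < d ->
    c * circ (s - t) <= enorm (gamma s - gamma t).
Proof.
move=> /andP[c0 c1]; have [eta eta0 he] := loop_chord_ge_local c1.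
have [d d0 hd] := loop_separation eta0; exists d => // s t /hd.
have [k ->] := circle_dist_attained hL (s - t) => hst.
have -> : gamma s = gamma (t + (s - t - k%:~R * L)).
  by rewrite -[LHS](loopDz _ (- k)); congr gamma; rewrite intrN; ring.
move: hst; set h := s - t - _ => hst.
have [h0|h0] := leP 0 h.
  by rewrite ger0_norm// he// h0 -(ger0_norm h0) ltW.
(* For negative [h] the local bound is started from the other end, [t + h]. *)
rewrite ltr0_norm// -enormN [- (gamma _ - _)]opprB.
have := he (t + h) (- h); rewrite addrK; apply.
by rewrite oppr_ge0 ltW//= -ltr0_norm// ltW.
Qed.

End Loop.

(** * Geodesic distance on a closed curve *)

(** Heine's theorem: an [e / 2]-modulus [r] at [x] serves, after halving, for all points near [x],
    and compactness makes the choice uniform. *)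
Lemma segment_unif_continuous (R : realType) (V : normedModType R)
    (f : R -> V) (a b : R) : {within `[a, b], continuous f} ->
  forall e, 0 < e -> exists2 d, 0 < d & forall x y, x \in `[a, b] ->
    y \in `[a, b] -> `|x - y| < d -> `|f x - f y| < e.
Proof.
move=> /subspace_continuousP cf e e0.
have : \forall d \near 0, `[a, b] `<=` [set x | forall y, y \in `[a, b] ->
    `|x - y| < d -> `|f x - f y| < e].
  have /compact_near_coveringP/near_covering_withinP cK := @segment_compact R a b.
  apply: (cK R (nbhs (0 : R)) (fun d x => forall y, y \in `[a, b] ->
    `|x - y| < d -> `|f x - f y| < e)).
  move=> x xab; have e2 : 0 < e / 2 by rewrite divr_gt0.
  have /cvgrPdist_lt/(_ _ e2) := cf x xab.
  rewrite /within/= => /nbhs_ballP[r /= r0 hr].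
  have r2 : 0 < r / 2 by rewrite divr_gt0.
  exists (ball x (r / 2), ball 0 (r / 2)) => /=.
    by split; exact: nbhsx_ballx.
  move=> [z d] [/= hz hd] zab y yab zyd.
  rewrite /ball/= in hz; rewrite /ball/= sub0r normrN in hd.
  have hz' : `|f x - f z| < e / 2.
    by apply: hr => //; rewrite /ball/=; lra.
  have hy' : `|f x - f y| < e / 2.
    apply: hr; rewrite ?inE// /ball/=.
    have := ler_distD z x y; have := ler_norm d; lra.
  by have := ler_distD (f x) (f z) (f y); rewrite (distrC (f z) (f x)); lra.
move=> /nbhs_ballP[d /= d0 hd]; exists (d / 2); first by rewrite divr_gt0.
move=> x y xab yab xy; apply: (hd (d / 2)) => //.
by rewrite /ball/= sub0r normrN gtr0_norm; lra.
Qed.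

Lemma itv_partition_nth_lt (R : realType) (a b : R) (p : seq R) k :
  itv_partition a b p -> (k < size p)%N ->
  nth 0 (a :: p) k < nth 0 (a :: p) k.+1.
Proof. by move=> [/(pathP 0) h _] /h. Qed.

Lemma itv_partition_nth_last (R : realType) (a b : R) (p : seq R) :
  itv_partition a b p -> nth 0 (a :: p) (size p) = b.
Proof. by move=> [_ /eqP <-]; rewrite (last_nth 0). Qed.

Lemma nth_uniform_partition (R : realType) (n k : nat) : (k <= n)%N ->
  nth 0 ((0 : R) :: [seq k.+1%:R / n%:R | k <- iota 0 n]) k = k%:R / n%:R.
Proof.
case: k => [_|k kn] /=; first by rewrite mul0r.
by rewrite (nth_map 0%N) ?size_iota// nth_iota.
Qed.

Lemma uniform_itv_partition (R : realType) (n : nat) : (0 < n)%N ->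
  itv_partition (0 : R) 1 [seq k.+1%:R / n%:R | k <- iota 0 n].
Proof.
move=> n0; have n0' : 0 < n%:R :> R by rewrite ltr0n.
set p := [seq _ | _ <- _].
have sp : size p = n by rewrite size_map size_iota.
split; last by rewrite (last_nth 0) sp nth_uniform_partition// divff// gt_eqF.
apply/(pathP 0) => k; rewrite sp => kn.
have -> : nth 0 p k = nth 0 (0 :: p) k.+1 by [].
by rewrite !nth_uniform_partition ?(ltnW kn)// ltr_pM2r ?invr_gt0// ltr_nat.
Qed.

Section Geodesic.
Variables (R : realType) (N : nat) (C : set 'rV[R]_N) (L : R).
Variables (gamma : R -> 'rV[R]_N).
Hypotheses (hL : 0 < L) (hg : unit_speed_loop C L gamma).
Local Notation circ := (circle_dist L).

(** Every chord is at most the increment of its parameters, and the increments telescope over the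
    partition. *)
Lemma path_length_arc s t :
  (path_length (fun u : R => gamma (s + u * (t - s))) <= `|t - s|%:E)%E.
Proof.
apply: ub_ereal_sup => _ /= [p hp <-]; rewrite lee_fin.
apply: (@le_trans _ _ (\sum_(0 <= k < size p)
   (`|t - s| * nth 0 (0 :: p) k.+1 - `|t - s| * nth 0 (0 :: p) k))).
  rewrite /polygon_length; apply: ler_sum_nat => k /andP[_ kp].
  apply: le_trans (loop_chord_le hg _ _) _.
  rewrite -mulrBr opprD addrACA subrr add0r -mulrBl normrM mulrC ler_wpM2l//.
  by rewrite gtr0_norm ?subr_gt0//; exact: itv_partition_nth_lt hp kp.
rewrite (telescope_sumr (fun k => `|t - s| * nth 0 (0 :: p) k)) ?leq0n//.
by rewrite (itv_partition_nth_last hp) /= mulr0 subr0 mulr1.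
Qed.

Lemma path_in_arc s t :
  path_in C (gamma s) (gamma t) (fun u : R => gamma (s + u * (t - s))).
Proof.
split.
- apply: continuous_subspaceT => u.
  apply: (@continuous_comp _ _ _ (fun u : R => s + u * (t - s)) gamma).
    by apply: cvgD; [exact: cvg_cst|apply: cvgM; [exact: cvg_id|exact: cvg_cst]].
  exact: (loop_continuous hg).
- by rewrite mul0r addr0.
- by rewrite mul1r addrC subrK.
- by rewrite (usl_range hg) => _ [u _ <-]; exists (s + u * (t - s)).
Qed.

(* No lift of sigma to the parameter line is needed: on a fine uniform partition
   every chord is at least c times the circular distance of the parameters, and
   these distances satisfy the triangle inequality. *)
Lemma path_length_ge s t (sigma : R -> 'rV[R]_N) :
  path_in C (gamma s) (gamma t) sigma ->
  ((circ (s - t))%:E <= path_length sigma)%E.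
Proof.
move=> [cs s0 s1 sC].
have /choice[theta htheta] (u : R) : exists v : R, u \in `[0, 1]%R ->
    gamma v = sigma u.
  have [u01|_] := boolP (u \in `[0, 1]%R); last by exists 0.
  have : C (sigma u) by apply: sC; exists u.
  by rewrite (usl_range hg) => -[v _ <-]; exists v.
(* It suffices to bound the length below by [c] times the circular distance for every [c] strictly
   between 0 and 1. *)
apply/lee_mul01Pr; first by rewrite lee_fin circle_dist_ge0.
move=> c /andP[c0 c1]; have c01 : 0 <= c < 1 by rewrite ltW.
have [d d0 hd] := loop_chord_ge hL hg c01.
(* A sup-norm step below [d / (N + 1)] has Euclidean norm below [d]; the [+ 1] keeps the divisor
   positive when [N] is 0. *)
have N0 : 0 < N%:R + 1 :> R by rewrite ltr_wpDl.
have [e e0 he] := segment_unif_continuous cs (divr_gt0 d0 N0).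
pose n := (Num.truncn e^-1).+1.
have n0 : 0 < n%:R :> R by rewrite ltr0n.
have ne : n%:R^-1 < e.
  by rewrite -[ltRHS]invrK ltf_pV2 ?posrE ?invr_gt0// truncnS_gt.
pose x k : R := k%:R / n%:R.
have x01 k : (k <= n)%N -> x k \in `[0, 1]%R.
  move=> kn; rewrite in_itv/= divr_ge0//= /x ler_pdivrMr// mul1r.
  by rewrite ler_nat.
have step k : (k < n)%N ->
    c * circ (theta (x k.+1) - theta (x k)) <= enorm (sigma (x k.+1) - sigma (x k)).
  move=> kn; have kn' := ltnW kn.
  rewrite -!htheta ?x01//; apply: hd; rewrite !htheta ?x01//.
  apply: le_lt_trans (enorm_le_norm _) _.
  have /he : `|x k.+1 - x k| < e.
    by rewrite /x -mulrBl -natr1 addrAC subrr add0r mul1r gtr0_norm ?invr_gt0.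
  rewrite !x01// => /(_ isT isT); rewrite ltr_pdivlMr// => /(le_lt_trans _); apply.
  by rewrite mulrC ler_wpM2l// lerDl.
have tri m : (m <= n)%N -> circ (theta (x m) - theta (x 0%N)) <=
    \sum_(0 <= k < m) circ (theta (x k.+1) - theta (x k)).
  elim: m => [_|m IH mn]; first by rewrite big_geq// subrr circle_dist0.
  rewrite big_nat_recr//= addrC.
  rewrite (le_trans (circle_dist_triangle hL (theta (x m)) _ _))//.
  by rewrite lerD2l IH// ltnW.
apply: le_trans (_ : ((polygon_length sigma
    [seq k.+1%:R / n%:R | k <- iota 0 n])%:E <= _)%E).
  rewrite -EFinM lee_fin.
  rewrite /polygon_length size_map size_iota.
  (* The chosen parameters of the two endpoints agree with [s] and [t] only up to multiples of
     [L]. *)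
  have -> : circ (s - t) = circ (theta (x n) - theta (x 0%N)).
    have [k hk] : exists k : int, theta (x 0%N) - s = k%:~R * L.
      by apply: (usl_simple hg); rewrite htheta ?x01// /x mul0r.
    have [l hl] : exists k : int, theta (x n) - t = k%:~R * L.
      by apply: (usl_simple hg); rewrite htheta ?x01// /x divff ?gt_eqF.
    rewrite (circle_distC hL) -(circle_distDz hL _ (l - k)) intrB mulrBl -hk -hl.
    by congr circle_dist; ring.
  apply: (@le_trans _ _ (\sum_(0 <= k < n) c * circ (theta (x k.+1) - theta (x k)))).
    by rewrite -mulr_sumr ler_wpM2l ?tri// ltW.
  apply: ler_sum_nat => k /andP[_ kn].
  by rewrite !nth_uniform_partition ?(ltnW kn)//; exact: step.
apply: ereal_sup_ubound => /=; exists [seq k.+1%:R / n%:R | k <- iota 0 n] => //.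
exact: uniform_itv_partition.
Qed.

Theorem geodesic_dist_loop s t :
  geodesic_dist C (gamma s) (gamma t) = circ (s - t).
Proof.
rewrite /geodesic_dist.
suff -> : ereal_inf [set path_length sigma | sigma in path_in C (gamma s) (gamma t)]
  = (circ (s - t))%:E by [].
apply/eqP; rewrite eq_le; apply/andP; split; last first.
  by apply: le_ereal_inf_tmp => _ [sigma hs <-]; exact: path_length_ge.
(* The upper bound is realized by the arc from [s] to the translate of [t] nearest to it. *)
have [k ->] := circle_dist_attained hL (s - t).
have -> : s - t - k%:~R * L = s - (t + k%:~R * L) by ring.
rewrite distrC -(loopDz hg t k); apply: le_trans (path_length_arc _ _).
apply: ereal_inf_lbound.
by exists (fun u : R => gamma (s + u * (t + k%:~R * L - s))) => //; exact: path_in_arc.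
Qed.

End Geodesic.

(** * The round circle *)

Lemma edot_rV2 (R : realType) (x y : 'rV[R]_2) :
  edot x y = x ord0 ord0 * y ord0 ord0 + x ord0 ord_max * y ord0 ord_max.
Proof.
rewrite /edot big_ord_recr/= big_ord1; congr (x _ _ * y _ _ + _); exact: val_inj.
Qed.

Section RoundCircle.
Variables (R : realType) (L : R).
Hypothesis hL : 0 < L.
Let r := L / (2 * pi).

Let pi0 : 0 < pi :> R := pi_gt0 R.

Let r0 : 0 < r. Proof. by rewrite divr_gt0// mulr_gt0. Qed.

Let LE : L = 2 * pi * r.
Proof. by rewrite /r mulrC divfK// gt_eqF// mulr_gt0. Qed.

Definition circle_velocity (s : R) : 'rV[R]_2 :=
  \row_(i < 2) (if i == ord0 then - sin (s / r) else cos (s / r)).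

Let is_derive_divr s : is_derive s (1 : R) (fun u => u / r) r^-1.
Proof.
rewrite (_ : (fun u => u / r) = r^-1 \*: id); last first.
  by apply/funext => u /=; rewrite mulrC.
have := @is_deriveZ _ _ _ (@id R) r^-1 s 1 1 (is_derive_id s 1).
by rewrite /GRing.scale/= mulr1.
Qed.

Lemma is_derive_circle_cos s :
  is_derive s (1 : R) (fun u => r * cos (u / r)) (- sin (s / r)).
Proof.
have d2 := is_derive1_comp (g := fun u => u / r) (is_derive_cos (s / r)) (is_derive_divr s).
have -> : - sin (s / r) = r *: (- sin (s / r) / r).
  by rewrite /GRing.scale/= [RHS]mulrC divfK// gt_eqF.
exact: is_deriveZ.
Qed.

Lemma is_derive_circle_sin s :
  is_derive s (1 : R) (fun u => r * sin (u / r)) (cos (s / r)).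
Proof.
have d2 := is_derive1_comp (g := fun u => u / r) (is_derive_sin (s / r)) (is_derive_divr s).
have -> : cos (s / r) = r *: (cos (s / r) / r).
  by rewrite /GRing.scale/= [RHS]mulrC divfK// gt_eqF.
exact: is_deriveZ.
Qed.

Lemma round_circle_derivable s : derivable (round_circle_param L) s 1.
Proof.
apply/derivable_mxP => i j; rewrite /round_circle_param -/r.
under eq_fun do rewrite mxE.
case: (j == ord0).
  by have [] := is_derive_circle_cos s.
by have [] := is_derive_circle_sin s.
Qed.

Lemma derive1_round_circle s :
  derive1 (round_circle_param L) s = circle_velocity s.
Proof.
rewrite derive1E derive_mx; last exact: round_circle_derivable.
apply/matrixP => i j; rewrite !mxE /round_circle_param -/r.
under eq_fun do rewrite mxE.
by case: (j == ord0); apply: derive_val;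
  [exact: is_derive_circle_cos|exact: is_derive_circle_sin].
Qed.

Lemma circle_velocity_continuous : continuous circle_velocity.
Proof.
move=> s; apply/differentiable_continuous/derivable1_diffP.
(* The velocity is the position a quarter turn ahead, rescaled by the inverse radius, so it inherits
   differentiability. *)
have e : circle_velocity = fun u => r^-1 *: round_circle_param L (u + L / 4).
  apply/funext => u; apply/rowP => i; rewrite !mxE -/r mulrDl.
  have -> : L / 4 / r = pi / 2 by rewrite LE; field; rewrite gt_eqF.
  have ri x : r^-1 * (r * x) = x by rewrite mulKr// unitfE gt_eqF.
  by case: (i == ord0); rewrite ri ?cosDpihalf ?sinDpihalf.
rewrite e; apply/derivable1_diffP.
apply: differentiableZ.
apply: (@differentiable_comp _ _ _ _ (fun u : R => u + L / 4) (round_circle_param L)).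
  exact: differentiableD.
exact/derivable1_diffP/round_circle_derivable.
Qed.

(** The hypotheses give [cos (x - y) = 1]. Removing the nearest multiple of [2 * pi] leaves an
    absolute value in [[0, pi]], where [acos] inverts [cos]. *)
Lemma cos_sin_inj_mod (x y : R) : cos x = cos y -> sin x = sin y ->
  exists k : int, x - y = k%:~R * (2 * pi).
Proof.
move=> hc hs.
have h1 : cos (x - y) = 1 by rewrite cosB hc hs -!expr2 cos2Dsin2.
have p2 : 0 < 2 * pi :> R by rewrite mulr_gt0.
have cosz : forall (k : int) (z : R), cos (z + k%:~R * (2 * pi)) = cos z.
  by apply: periodicz => u; rewrite mulr_natl cosD2pi.
have [k hk] := circle_dist_attained p2 (x - y).
exists k; have hle := circle_dist_le_half (2 * pi) (x - y).
rewrite hk in hle.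
have : cos `|x - y - k%:~R * (2 * pi)| = 1.
  by rewrite cos_norm -mulNr -intrN cosz.
move=> /(congr1 (@acos R)); rewrite acos1 cosK; last first.
  by rewrite in_itv/= normr_ge0; lra.
by move=> /eqP; rewrite normr_eq0 subr_eq0 => /eqP.
Qed.

Lemma round_circle_loop :
  unit_speed_loop (round_circle L) L (round_circle_param L).
Proof.
split.
- apply/seteqP; split=> [x|_ [s _ <-]]; rewrite /round_circle /esphere /= -/r.
    move=> hx; have : enorm x ^+ 2 = r ^+ 2 by rewrite hx.
    rewrite enorm_sqr edot_rV2 -!expr2.
    set a := x ord0 ord0; set b := x ord0 ord_max => hab.
    have har : `|a / r| <= 1.
      rewrite normrM normfV (gtr0_norm r0) ler_pdivrMr// mul1r.
      rewrite -(ler_pXn2r (n := 2)) ?nnegrE ?(ltW r0)// real_normK ?num_real//.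
      by rewrite -hab lerDl sqr_ge0.
    have har' : -1 <= a / r <= 1 by rewrite -ler_norml.
    have hsin : r * sin (acos (a / r)) = `|b|.
      rewrite sin_acos// -[X in X * _]gtr0_norm// -sqrtr_sqr -sqrtrM ?sqr_ge0//.
      rewrite -[RHS]sqrtr_sqr; congr Num.sqrt.
      have -> : r ^+ 2 * (1 - (a / r) ^+ 2) = r ^+ 2 - a ^+ 2 * (r / r) ^+ 2 by ring.
      by rewrite divff ?gt_eqF// expr1n mulr1 -hab addrC addKr.
    have hcos : r * cos (acos (a / r)) = a.
      by rewrite acosK ?in_itv//= mulrC divfK// gt_eqF.
    have row_eq (c : R) : r * cos c = a -> r * sin c = b ->
        round_circle_param L (r * c) = x.
      move=> hc hs; apply/rowP => i; rewrite mxE -/r [r * c]mulrC mulfK ?lt0r_neq0//.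
      have [->|i0] := eqVneq i ord0; first by rewrite hc.
      rewrite hs; congr (x _ _); apply: val_inj => /=.
      by case: i i0 => -[|[|]].
    (* Angles given by [acos] reach only the upper half circle; the lower half takes the opposite
       angle. *)
    have [b0|b0] := leP 0 b.
      exists (r * acos (a / r)) => //; apply: row_eq => //.
      by rewrite hsin ger0_norm.
    exists (r * - acos (a / r)) => //; apply: row_eq; first by rewrite cosN.
    by rewrite sinN mulrN hsin ltr0_norm// opprK.
  have : enorm (round_circle_param L s) ^+ 2 = r ^+ 2.
    rewrite enorm_sqr edot_rV2 !mxE/= -/r.
    by rewrite -[RHS]mulr1 -(cos2Dsin2 (s / r)); ring.
  by move=> /eqP; rewrite eqrXn2 ?enorm_ge0// ?ltW// => /eqP.
- exact: round_circle_derivable.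
- by rewrite (_ : derive1 _ = circle_velocity);
    [exact: circle_velocity_continuous|apply/funext => s; exact: derive1_round_circle].
- move=> s; rewrite derive1_round_circle.
  have : enorm (circle_velocity s) ^+ 2 = 1 ^+ 2.
    rewrite enorm_sqr edot_rV2 !mxE/= expr1n -(cos2Dsin2 (s / r)); ring.
  by move=> /eqP; rewrite eqrXn2 ?enorm_ge0// => /eqP.
- move=> s; apply/rowP => i; rewrite !mxE -/r mulrDl.
  have -> : L / r = pi *+ 2 by rewrite LE mulfK ?gt_eqF// mulr_natl.
  by rewrite cosD2pi sinD2pi.
- move=> s t h.
  have hi i := congr1 (fun M : 'rV[R]_2 => M ord0 i) h.
  have := hi ord0; rewrite !mxE/= -/r => /(mulfI (lt0r_neq0 r0)) hc.
  have := hi ord_max; rewrite !mxE/= -/r => /(mulfI (lt0r_neq0 r0)) hs.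
  have [k hk] := cos_sin_inj_mod hc hs; exists k.
  by rewrite LE mulrA -hk -mulrBl divfK// gt_eqF.
Qed.

End RoundCircle.

(** * Distortion as an integral over the parameter *)

(* Circular distances are at most L / 2, so for m > 0 the default value L ^+ 2 of
   the iterated minimum is never attained. *)
Definition sqdist_min (R : realType) (L : R) (m : nat) (t : nat -> R) (s : R) : R :=
  \big[Num.min/L ^+ 2]_(k < m) circle_dist L (s - t k) ^+ 2.

Section SqdistMin.
Variables (R : realType) (L : R).
Hypothesis hL : 0 < L.
Variables (m : nat) (t : nat -> R).
Local Notation circ := (circle_dist L).

Lemma sqdist_min_le s k : (k < m)%N -> sqdist_min L m t s <= circ (s - t k) ^+ 2.
Proof.
move=> km; exact: (bigmin_le _ (Ordinal km) (fun k : 'I_m => circ (s - t k) ^+ 2)).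
Qed.

Lemma sqdist_min_attained s : (0 < m)%N ->
  exists2 k, (k < m)%N & sqdist_min L m t s = circ (s - t k) ^+ 2.
Proof.
move=> m0; have h : forall k : 'I_m, true -> circ (s - t k) ^+ 2 <= L ^+ 2.
  move=> k _; rewrite lerXn2r ?nnegrE ?circle_dist_ge0 ?(ltW hL)//.
  by apply: le_trans (circle_dist_le_half _ _) _; rewrite ler_pdivrMr// ler_pMr// ler1n.
have := @bigmin_eq_arg _ _ _ (L ^+ 2) (Ordinal m0) predT
  (fun k : 'I_m => circ (s - t k) ^+ 2) isT h.
set k := (X in t (nat_of_ord X)) => e; exists (k : nat) => //.
Qed.

Lemma sqdist_min_ge0 s : 0 <= sqdist_min L m t s.
Proof.
have [m0|] := posnP m; last by move=> /(sqdist_min_attained s)[k _ ->]; exact: sqr_ge0.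
by rewrite /sqdist_min m0 big_ord0 sqr_ge0.
Qed.

Lemma sqdist_min_continuous : continuous (sqdist_min L m t).
Proof.
apply: continuous_big => [|k _]; first exact: min_continuous.
move=> s; apply: (@cvg_comp _ _ _ (fun s => circ (s - t k))
  (fun x : R => x ^+ 2)); last first.
  exact: exprn_continuous.
apply: (@continuous_comp _ _ _ (fun s => s - t k) circ).
  by apply: cvgB; [exact: cvg_id|exact: cvg_cst].
exact: circle_dist_continuous.
Qed.

End SqdistMin.

Section Distortion.
Variables (R : realType) (N : nat) (C : set 'rV[R]_N) (L : R).
Variables (gamma : R -> 'rV[R]_N).
Hypotheses (hL : 0 < L) (hg : unit_speed_loop C L gamma).
Local Notation circ := (circle_dist L).

Lemma open_borel_rV (U : set 'rV[R]_N) : open U -> measurable (U : set (borel_rV R N)).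
Proof. exact: sub_sigma_algebra. Qed.

Lemma closed_borel_rV (F : set 'rV[R]_N) :
  closed F -> measurable (F : set (borel_rV R N)).
Proof.
move=> cF; rewrite -[F]setCK; apply: measurableC.
by apply: open_borel_rV; rewrite openC.
Qed.

(* The set is the image of a compact set of parameters. *)
Lemma loop_preimage_closed (T : topologicalType) (f : 'rV[R]_N -> T) (F : set T) :
  continuous (f \o gamma) -> closed F ->
  measurable (C `&` f @^-1` F : set (borel_rV R N)).
Proof.
move=> cf cF; apply: closed_borel_rV.
have -> : C `&` f @^-1` F = gamma @` (`[0, L] `&` (f \o gamma) @^-1` F).
  rewrite (usl_range hg); apply/seteqP; split=> [_ [[s _ <-] /= Fs]|_ [s [_ Fs] <-]].
    have [k k0 kL] := floor_reduction s hL.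
    exists (s - k%:~R * L); rewrite -mulNr -intrN /= (loopDz hg)//.
    by rewrite in_itv/= intrN mulNr k0 ltW.
  by split => //; exists s.
apply: compact_closed; first exact: norm_hausdorff.
apply: continuous_compact.
  by apply: continuous_subspaceT; exact: (loop_continuous hg).
apply: (subclosed_compact _ (@segment_compact R 0 L)).
  apply: closedI; first exact: interval_closed.
  exact: closed_comp.
exact: subIsetl.
Qed.

Lemma loop_measurable : measurable (C : set (borel_rV R N)).
Proof.
rewrite -[C]setIT -(preimage_setT (fun=> 0 : R)).
by apply: loop_preimage_closed; [exact: cst_continuous|exact: closedT].
Qed.

Lemma loop_preimage_open (T : topologicalType) (f : 'rV[R]_N -> T) (U : set T) :
  continuous (f \o gamma) -> open U ->
  measurable (C `&` f @^-1` U : set (borel_rV R N)).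
Proof.
move=> cf oU.
have -> : C `&` f @^-1` U = C `\` (C `&` f @^-1` (~` U)).
  apply/seteqP; split=> x /= [Cx h]; split => //; first by move=> [_]; apply.
  by apply: contrapT => nU; apply: h.
apply: measurableD; first exact: loop_measurable.
by apply: loop_preimage_closed => //; rewrite closedC.
Qed.

(** The hypothesis is on [f \o gamma] because functions on the curve are known here through formulas
    in the parameter. *)
Lemma loop_measurable_fun (f : borel_rV R N -> R) :
  continuous (f \o gamma) -> measurable_fun (C : set (borel_rV R N)) f.
Proof.
move=> cf; apply: (measurability _ (RGenOpens.measurableE R)).
by move=> _ [_ [a [b ->] <-]]; apply: loop_preimage_open => //; exact: interval_open.
Qed.

Lemma loop_measurable_fun_rV (M : nat) (f : borel_rV R N -> borel_rV R M) :
  continuous (f \o gamma : R -> 'rV[R]_M) ->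
  measurable_fun (C : set (borel_rV R N)) f.
Proof.
move=> cf; apply: (@measurability _ _ (borel_rV R N) (borel_rV R M) C f
  (@open 'rV[R]_M)) => //.
by move=> _ [U oU <-]; exact: loop_preimage_open.
Qed.

Lemma measurable_loop : measurable_fun setT (gamma : R -> borel_rV R N).
Proof.
apply: (@measurability _ _ _ (borel_rV R N) setT gamma (@open 'rV[R]_N)) => //.
move=> _ [U oU <-]; rewrite setTI; apply: open_measurable.
by apply: open_comp => // s _; exact: (loop_continuous hg).
Qed.

Lemma ereal_inf_sqdist (m : nat) (t : nat -> R) s : (0 < m)%N ->
  ereal_inf [set (geodesic_dist C (gamma s) a ^+ 2)%:E
     | a in [set gamma (t k) | k in `I_m]] = (sqdist_min L m t s)%:E.
Proof.
move=> m0; apply/eqP; rewrite eq_le; apply/andP; split.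
  have [k km ->] := sqdist_min_attained hL t s m0.
  apply: ereal_inf_lbound; exists (gamma (t k)); first by exists k.
  by rewrite (geodesic_dist_loop hL hg).
apply: le_ereal_inf_tmp => _ [_ [k km <-] <-].
by rewrite (geodesic_dist_loop hL hg) lee_fin; exact: sqdist_min_le.
Qed.

Variable P : probability (borel_rV R N) R.
Hypothesis hP : uniform_on_curve hL gamma P.

Lemma uniform_on_curve_full : P C = 1%E.
Proof.
rewrite hP; last exact: loop_measurable.
rewrite /pushforward (_ : gamma @^-1` C = setT) ?probability_setT//.
by apply/seteqP; split => // s _; rewrite (usl_range hg); exists s.
Qed.

Lemma integral_loop (G : borel_rV R N -> \bar R) (g : R -> R) :
  continuous g -> (forall s, 0 <= g s) -> (forall s, G (gamma s) = (g s)%:E) ->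
  (\int[P]_(x in C) G x =
   (L^-1)%:E * \int[lebesgue_measure]_(s in `[0%R, L]) (g s)%:E)%E.
Proof.
move=> cg g0 hG.
rewrite (@eq_measure_integral _ _ _ _
  (pushforward (uniform_prob hL) (gamma : R -> borel_rV R N))).
  exact: measurable_loop.
2: by move=> mg A mA _; exact: hP.
move=> mg; rewrite ge0_integral_pushforward; first last.
- by move=> x; rewrite inE [X in X x](usl_range hg) => -[s _ <-]; rewrite hG lee_fin.
(* [G] is finite on [C], so it coincides there with a real function that is continuous along
   [gamma]. *)
- have : measurable_fun (C : set (borel_rV R N)) (EFin \o (fine \o G)).
    apply/measurable_EFinP; apply: loop_measurable_fun.
    by rewrite (_ : _ \o gamma = g)//; apply/funext => s /=; rewrite hG.
  apply: eq_measurable_fun => x; rewrite inE (usl_range hg) => -[s _ <-] /=.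
  by rewrite hG.
- exact: loop_measurable.
- exact: measurable_loop.
rewrite (_ : gamma @^-1` C = setT); last first.
  by apply/seteqP; split => // s _; rewrite (usl_range hg); exists s.
rewrite (_ : G \o gamma = EFin \o g); last exact/funext.
rewrite integral_uniform ?subr0//.
by apply/measurable_EFinP; exact: continuous_measurable_fun.
Qed.

Lemma distortion_loop (m : nat) (t : nat -> R) : (0 < m)%N ->
  distortion P C (geodesic_dist C) [set gamma (t k) | k in `I_m] =
  ((L^-1)%:E * \int[lebesgue_measure]_(s in `[0%R, L]) (sqdist_min L m t s)%:E)%E.
Proof.
move=> m0; apply: integral_loop => [|s|s].
- exact: sqdist_min_continuous.
- exact: sqdist_min_ge0.
- exact: ereal_inf_sqdist.
Qed.

Lemma distortion_loop0 : distortion P C (geodesic_dist C) set0 = +oo%E.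
Proof.
rewrite /distortion; under eq_integral do rewrite image_set0 ereal_inf0.
rewrite integral_cst; last exact: loop_measurable.
by rewrite [X in (_ * X)%E](_ : _ = 1%E) ?mule1//; exact: uniform_on_curve_full.
Qed.

(** Replaces a codebook by a family of parameters without repetition, so that [sqdist_min] applies
    and the number of indices is the cardinality. *)
Lemma finite_loop_subset (alpha : set 'rV[R]_N) : alpha `<=` C -> finite_set alpha ->
  exists m (t : nat -> R), [/\ alpha = [set gamma (t k) | k in `I_m],
    alpha #= `I_m &
    forall i j, (i < m)%N -> (j < m)%N -> gamma (t i) = gamma (t j) -> i = j].
Proof.
move=> aC /finite_seqP[s0 es0].
pose s := undup s0.
have es : alpha = [set` s].
  by rewrite es0; apply/seteqP; split=> x /=; rewrite mem_undup.
have us : uniq s := undup_uniq _.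
have /choice[t ht] (k : nat) : exists u : R, (k < size s)%N -> gamma u = nth 0 s k.
  have [ks|_] := ltnP k (size s); last by exists 0.
  have : C (nth 0 s k) by apply: aC; rewrite es /=; exact: mem_nth.
  by rewrite (usl_range hg) => -[u _ <-]; exists u.
have inj i j : (i < size s)%N -> (j < size s)%N -> gamma (t i) = gamma (t j) -> i = j.
  by move=> hi hj; rewrite !ht// => /eqP; rewrite nth_uniq// => /eqP.
have ea : alpha = [set gamma (t k) | k in `I_(size s)].
  rewrite es; apply/seteqP; split=> [x /= xs|_ [k /= ks <-]].
    exists (index x s); first by rewrite /= index_mem.
    by rewrite ht ?index_mem// nth_index.
  by rewrite ht//; exact: mem_nth.
exists (size s), t; split => //.
rewrite ea; apply: inj_card_eq => i j; rewrite !inE /= => hi hj.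
exact: inj.
Qed.

End Distortion.

(** * Integrals of periodic functions *)

Section SegmentIntegral.
Variable R : realType.
Implicit Types (f g : R -> R) (a b c : R).
Local Notation mu := (@lebesgue_measure R).

Lemma continuous_itv_integrable f a b : continuous f ->
  mu.-integrable `[a, b] (EFin \o f).
Proof.
move=> cf; apply: continuous_compact_integrable; first exact: segment_compact.
exact: continuous_subspaceT.
Qed.

Lemma integral_itvE f a b : continuous f ->
  (\int[mu]_(s in `[a, b]) (f s)%:E)%E = (\int[mu]_(s in `[a, b]) f s)%:E.
Proof.
move=> cf; rewrite /Rintegral fineK//; apply: integrable_fin_num => //.
exact: continuous_itv_integrable.
Qed.

Lemma Rintegral_itv_split f a b c : continuous f -> a <= b -> b <= c ->
  \int[mu]_(s in `[a, c]) f s =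
  \int[mu]_(s in `[a, b]) f s + \int[mu]_(s in `[b, c]) f s.
Proof.
move=> cf ab bc.
have iac := continuous_itv_integrable a c cf.
have := @Rintegral_itvB R f (BLeft a) (BRight c) b iac.
rewrite !bnd_simp => /(_ ab bc); rewrite Rintegral_itv_obnd_cbnd => [<-|].
  by rewrite addrC subrK.
apply: integrableS (continuous_itv_integrable b c cf) => //.
by apply: subset_itvr; rewrite bnd_simp.
Qed.

Lemma Rintegral_itv_shift f a b c : continuous f -> a <= b ->
  \int[mu]_(s in `[a + c, b + c]) f s = \int[mu]_(s in `[a, b]) f (s + c).
Proof.
move=> cf ab; rewrite /Rintegral; congr fine.
have d1 : (fun s : R => s + c)^`()%classic = cst 1.
  apply/funext => s; rewrite derive1E deriveD// derive_id derive_cst addr0//.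
rewrite (@integration_by_substitution_increasing _ (fun s => s + c) f a b)//.
- by apply: eq_integral => s _; rewrite d1 /= mulr1.
- by move=> x y _ _ xy; rewrite ltrD2r.
- by rewrite d1 => s _; exact: cst_continuous.
- by rewrite d1; exact: is_cvg_cst.
- by rewrite d1; exact: is_cvg_cst.
- have cs : continuous (fun s : R => s + c).
    by move=> s; apply: cvgD; [exact: cvg_id|exact: cvg_cst].
  split; first by move=> s _; exact: derivableD.
    by apply: cvg_at_right_filter; exact: cs.
  by apply: cvg_at_left_filter; exact: cs.
- exact: continuous_subspaceT.
Qed.

(** A translation by a multiple of [L] reduces [c] to some [d] in [[0, L)]. The window from [d] to
    [d + L] is cut at [L], and its second piece moves back to [[0, d]]. *)
Lemma Rintegral_periodic f (L c : R) : 0 < L -> continuous f ->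
  (forall s, f (s + L) = f s) ->
  \int[mu]_(s in `[c, c + L]) f s = \int[mu]_(s in `[0, L]) f s.
Proof.
move=> hL cf pf; have [k k0 kL] := floor_reduction c hL.
set d := c - k%:~R * L.
have -> : c = d + k%:~R * L by rewrite /d subrK.
rewrite [d + _ + L]addrAC Rintegral_itv_shift//; last by rewrite lerDl ltW.
under eq_Rintegral do rewrite (periodicz pf).
have dL : d <= L by exact: ltW.
rewrite (@Rintegral_itv_split f d L (d + L))//; last by rewrite lerDr.
rewrite (@Rintegral_itv_split f 0 d L)// addrC; congr (_ + _).
rewrite -{1}(add0r L) Rintegral_itv_shift//.
by apply: eq_Rintegral => s _; rewrite pf.
Qed.

Lemma Rintegral_itv_sum (m : nat) (g : nat -> R -> R) a b :
  (forall k, continuous (g k)) ->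
  \int[mu]_(s in `[a, b]) (\sum_(k < m) g k s) =
  \sum_(k < m) \int[mu]_(s in `[a, b]) g k s.
Proof.
move=> cg; elim: m => [|m IH].
  under eq_Rintegral do rewrite big_ord0.
  by rewrite big_ord0 Rintegral_cst//= mul0r.
under eq_Rintegral do rewrite big_ord_recr /=.
rewrite big_ord_recr/= -IH RintegralD//; try exact: continuous_itv_integrable.
apply: (@continuous_itv_integrable (fun s => \sum_(k < m) g k s)).
by apply: continuous_big => [|k _]; [exact: add_continuous|exact: cg].
Qed.

(** Were [f s] positive, [f] would exceed [f s / 2] around [s]. The period window centred at [s]
    contains that neighbourhood even when [s] is an end of [[0, L]]. *)
Lemma Rintegral_periodic_eq0 f (L : R) : 0 < L -> continuous f ->
  (forall s, f (s + L) = f s) -> (forall s, 0 <= f s) ->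
  \int[mu]_(s in `[0, L]) f s = 0 -> forall s, f s = 0.
Proof.
move=> hL cf pf f0 I0 s; apply/eqP; rewrite eq_le f0 andbT leNgt; apply/negP => fs.
have fs2 : 0 < f s / 2 by rewrite divr_gt0.
have /cvgrPdist_lt/(_ _ fs2)/nbhs_ballP[e /= e0 he] := cf s.
pose d := Num.min (e / 2) (L / 2).
have d0 : 0 < d by rewrite lt_min !divr_gt0.
have de : d < e.
  by rewrite gt_min; apply/orP; left; rewrite ltr_pdivrMr// ltr_pMr// ltr1n.
have dL : d <= L / 2 by rewrite ge_min lexx orbT.
have : 0 < \int[mu]_(x in `[s - L / 2, s - L / 2 + L]) f x.
  rewrite (@Rintegral_itv_split f _ (s - d))//; [|lra|lra].
  rewrite (@Rintegral_itv_split f (s - d) (s + d))//; [|lra|lra].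
  have h1 : 0 <= \int[mu]_(x in `[s - L / 2, s - d]) f x.
    by apply: Rintegral_ge0.
  have h2 : 0 <= \int[mu]_(x in `[s + d, s - L / 2 + L]) f x.
    by apply: Rintegral_ge0.
  have h3 : 0 < \int[mu]_(x in `[s - d, s + d]) (f s / 2).
    rewrite Rintegral_cst//= lebesgue_measure_itv/= lte_fin ifT; last by lra.
    by rewrite -EFinD /= mulr_gt0//; lra.
  have h4 : \int[mu]_(x in `[s - d, s + d]) (f s / 2) <=
      \int[mu]_(x in `[s - d, s + d]) f x.
    apply: le_Rintegral => //.
    - by apply: continuous_itv_integrable; exact: cst_continuous.
    - exact: continuous_itv_integrable.
    - move=> x; rewrite /= in_itv/= => /andP[x1 x2].
      have /he : ball s e x.
        by rewrite /ball/= (le_lt_trans _ de)// ler_norml; apply/andP; split; lra.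
      by rewrite ltr_norml => /andP[_]; lra.
  by rewrite ltr_wpDl// ltr_wpDr// (lt_le_trans h3).
by rewrite Rintegral_periodic// I0 ltxx.
Qed.

Lemma Rintegral_parabola (r t : R) : 0 < r ->
  \int[mu]_(s in `[t - r, t + r]) (r ^+ 2 - (s - t) ^+ 2) = 4 / 3 * r ^+ 3.
Proof.
move=> r0.
pose p : {poly R} := (r ^+ 2) *: 'X - 3^-1 *: ('X - t%:P) ^+ 3.
have dp s : p^`().[s] = r ^+ 2 - (s - t) ^+ 2.
  rewrite /p derivB !derivZ derivX deriv_exp derivXsubC !hornerE /=.
  by field.
rewrite /Rintegral (@continuous_FTC2 _ _ (horner p)).
- by rewrite -EFinB /= /p !hornerE /=; field.
- by lra.
- apply: continuous_subspaceT; rewrite (_ : (fun s => _) = horner p^`()).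
    exact: continuous_horner.
  by apply/funext => s; rewrite dp.
- split; first by move=> s _; exact: derivable_horner.
    by apply: cvg_at_right_filter; exact: continuous_horner.
  by apply: cvg_at_left_filter; exact: continuous_horner.
- by move=> s _; rewrite -derivE dp.
Qed.

End SegmentIntegral.

(** * Truncated parabolas on the circle *)

Section Bump.
Variables (R : realType) (L r : R).
Hypotheses (hL : 0 < L) (r0 : 0 < r) (rL : r <= L / 2).
Local Notation circ := (circle_dist L).
Local Notation mu := (@lebesgue_measure R).

(** The amount by which a codepoint at [t] can lower the squared distance at [s] below the level
    [r ^+ 2]. *)
Definition bump (t s : R) : R := Num.max 0 (r ^+ 2 - circ (s - t) ^+ 2).

Lemma bump_ge0 t s : 0 <= bump t s.
Proof. by rewrite le_max lexx. Qed.

Lemma bump_ge t s : r ^+ 2 - circ (s - t) ^+ 2 <= bump t s.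
Proof. by rewrite le_max lexx orbT. Qed.

Lemma bump_near t s : circ (s - t) <= r -> bump t s = r ^+ 2 - circ (s - t) ^+ 2.
Proof.
move=> h; rewrite /bump max_r// subr_ge0 lerXn2r// ?nnegrE ?circle_dist_ge0//.
exact: ltW.
Qed.

Lemma bump_far t s : r <= circ (s - t) -> bump t s = 0.
Proof.
move=> h; rewrite /bump max_l// subr_le0 lerXn2r// ?nnegrE ?circle_dist_ge0//.
exact: ltW.
Qed.

Lemma bump_gt0 t s : circ (s - t) < r -> 0 < bump t s.
Proof.
move=> h; rewrite bump_near ?ltW// subr_gt0 ltrXn2r ?nnegrE ?circle_dist_ge0// ltW.
Qed.

Lemma bump_continuous t : continuous (bump t).
Proof.
move=> s; rewrite /bump; apply: (@continuous_max R R (cst 0)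
  (fun s => r ^+ 2 - circ (s - t) ^+ 2)); first exact: cst_continuous.
apply: cvgB; first exact: cvg_cst.
apply: (@cvg_comp _ _ _ (fun s => circ (s - t)) (fun x : R => x ^+ 2)); last first.
  exact: exprn_continuous.
apply: (@continuous_comp _ _ _ (fun s => s - t) circ).
  by apply: cvgB; [exact: cvg_id|exact: cvg_cst].
exact: circle_dist_continuous.
Qed.

Lemma bump_periodic t s : bump t (s + L) = bump t s.
Proof.
have := circle_distDz hL (s - t) 1.
by rewrite /bump mul1r addrAC => ->.
Qed.

(** Over the period that starts at [t - r], the bump is a full parabola on the first [2 r] and
    vanishes on the rest, which exists because [r <= L / 2]. *)
Lemma Rintegral_bump t :
  \int[mu]_(s in `[0, L]) bump t s = 4 / 3 * r ^+ 3.
Proof.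
rewrite -(@Rintegral_periodic _ _ L (t - r))//; last 2 first.
- exact: bump_continuous.
- exact: bump_periodic.
have h1 : t - r <= t + r by move: r0; lra.
have h2 : t + r <= t - r + L by move: rL; lra.
rewrite (Rintegral_itv_split (@bump_continuous t) h1 h2).
rewrite -[RHS]addr0; congr (_ + _).
  rewrite -(Rintegral_parabola t r0); apply: eq_Rintegral => s.
  rewrite inE/= in_itv/= => /andP[s1 s2].
  have h : `|s - t| <= r by rewrite ler_norml; apply/andP; split; lra.
  have e : circ (s - t) = `|s - t| by rewrite circle_dist_small// (le_trans h).
  by rewrite bump_near e// real_normK// num_real.
rewrite -[RHS](mul0r (fine (mu `[t + r, t - r + L]))) -Rintegral_cst//.
apply: eq_Rintegral => s; rewrite inE/= in_itv/= => /andP[s1 s2].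
rewrite bump_far//; have [k ->] := circle_dist_attained hL (s - t).
have [k0|k0] := leP k 0.
  have : (k%:~R : R) * L <= 0 by rewrite pmulr_lle0// lerz0.
  by move=> h; rewrite ger0_norm; lra.
have : L <= (k%:~R : R) * L by rewrite ler_pMl// -[1]/(1%:~R) ler_int -gtz0_ge1.
by move=> h; rewrite ler0_norm; lra.
Qed.

End Bump.

(** * The lower bound and its equality case *)

(* The closed arcs of half-length r around the t k cover the circle, and the open
   ones are disjoint. *)
Record tiling (R : realType) (L r : R) (m : nat) (t : nat -> R) : Prop := Tiling {
  tiling_cover : forall s, exists2 k, (k < m)%N & circle_dist L (s - t k) <= r;
  tiling_sep : forall s j k, (j < m)%N -> (k < m)%N ->
    circle_dist L (s - t j) < r -> circle_dist L (s - t k) < r -> j = k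
}.

Section Core.
Variables (R : realType) (L r : R) (m : nat) (t : nat -> R).
Hypotheses (hL : 0 < L) (r0 : 0 < r) (rL : r <= L / 2) (m0 : (0 < m)%N).
Local Notation circ := (circle_dist L).
Local Notation mu := (@lebesgue_measure R).
Local Notation D := (sqdist_min L m t).
Local Notation bump := (bump L r).

(** The bump of the nearest codepoint suffices for the bound, and the other bumps are
    nonnegative. *)
Lemma sqdist_min_ge s : r ^+ 2 - \sum_(k < m) bump (t k) s <= D s.
Proof.
have [i im ->] := sqdist_min_attained hL t s m0.
rewrite lerBlDr -lerBlDl (le_trans (bump_ge _ _ (t i) _))//.
by rewrite (bigD1 (Ordinal im))//= lerDl sumr_ge0// => k _; exact: bump_ge0.
Qed.

Lemma sum_bump_continuous : continuous (fun s => \sum_(k < m) bump (t k) s).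
Proof.
by apply: continuous_big => [|k _]; [exact: add_continuous|exact: bump_continuous].
Qed.

Lemma Rintegral_bound : \int[mu]_(s in `[0, L]) (r ^+ 2 - \sum_(k < m) bump (t k) s) =
  L * r ^+ 2 - m%:R * (4 / 3 * r ^+ 3).
Proof.
rewrite RintegralB//; last 2 first.
- by apply: continuous_itv_integrable; exact: cst_continuous.
- by apply: continuous_itv_integrable; exact: sum_bump_continuous.
rewrite Rintegral_cst//= lebesgue_measure_itv/= lte_fin hL -EFinD/= subr0 mulrC.
rewrite (@Rintegral_itv_sum _ m (fun k => bump (t k))); last first.
  by move=> k; exact: bump_continuous.
under eq_bigr do rewrite Rintegral_bump//.
by congr (_ - _); rewrite sumr_const card_ord [RHS]mulr_natl.
Qed.

Lemma sqdist_min_lower_bound :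
  L * r ^+ 2 - m%:R * (4 / 3 * r ^+ 3) <= \int[mu]_(s in `[0, L]) D s.
Proof.
rewrite -Rintegral_bound; apply: le_Rintegral => //.
- apply: (@continuous_itv_integrable _ (fun s => r ^+ 2 - \sum_(k < m) bump (t k) s)).
  by move=> s; apply: cvgB; [exact: cvg_cst|exact: sum_bump_continuous].
- by apply: continuous_itv_integrable; exact: sqdist_min_continuous.
- by move=> s _; exact: sqdist_min_ge.
Qed.

Lemma sqdist_min_periodic s : D (s + L) = D s.
Proof.
apply: eq_bigr => k _; congr (_ ^+ 2).
by have := circle_distDz hL (s - t k) 1; rewrite mul1r addrAC.
Qed.

Lemma sqdist_min_tight :
  \int[mu]_(s in `[0, L]) D s = L * r ^+ 2 - m%:R * (4 / 3 * r ^+ 3) ->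
  forall s, D s = r ^+ 2 - \sum_(k < m) bump (t k) s.
Proof.
move=> e s; apply/eqP; rewrite -subr_eq0; apply/eqP.
pose g s := r ^+ 2 - \sum_(k < m) bump (t k) s.
have cg : continuous g.
  by move=> x; apply: cvgB; [exact: cvg_cst|exact: sum_bump_continuous].
have cD : continuous D by exact: sqdist_min_continuous.
apply: (@Rintegral_periodic_eq0 _ (fun s => D s - g s) L) => //.
- by move=> x; apply: cvgB; [exact: cD|exact: cg].
- move=> x; rewrite sqdist_min_periodic /g; congr (_ - (_ - _)).
  by apply: eq_bigr => k _; rewrite bump_periodic.
- by move=> x; rewrite subr_ge0 sqdist_min_ge.
- rewrite RintegralB//; try exact: continuous_itv_integrable.
  by rewrite Rintegral_bound e subrr.
Qed.

Lemma tight_tiling : (forall s, D s = r ^+ 2 - \sum_(k < m) bump (t k) s) ->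
  tiling L r m t.
Proof.
move=> hD; split=> [s|s j k jm km cj ck].
  have [i im e] := sqdist_min_attained hL t s m0; exists i => //.
  rewrite -(ler_pXn2r (n := 2)) ?nnegrE ?circle_dist_ge0 ?(ltW r0)// -e hD.
  by rewrite gerBl sumr_ge0// => l _; exact: bump_ge0.
have [i im e] := sqdist_min_attained hL t s m0.
(* Only the nearest codepoint [i] can be closer than [r]: its bump already equals the whole sum, so
   a second positive bump is impossible. *)
suff h l : (l < m)%N -> circ (s - t l) < r -> l = i by rewrite (h j)// (h k).
move=> lm cl; apply/eqP; apply: contraT => li.
have ci : circ (s - t i) <= r.
  rewrite -(ler_pXn2r (n := 2)) ?nnegrE ?circle_dist_ge0 ?(ltW r0)// -e.
  apply: le_trans (sqdist_min_le L t s lm) _.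
  by rewrite lerXn2r ?nnegrE ?circle_dist_ge0 ?ltW.
have : bump (t i) s = \sum_(k < m) bump (t k) s.
  by rewrite bump_near// -e hD opprB addrC subrK.
rewrite (bigD1 (Ordinal im))//= (bigD1 (Ordinal lm))//=.
have : 0 <= \sum_(k < m | (k != Ordinal im) && (k != Ordinal lm)) bump (t k) s.
  by apply: sumr_ge0 => q _; exact: bump_ge0.
have := bump_gt0 hL r0 cl; lra.
Qed.

(** By covering, the nearest codepoint is within [r]; by separation, all other bumps vanish. *)
Lemma tiling_tight : tiling L r m t ->
  forall s, D s = r ^+ 2 - \sum_(k < m) bump (t k) s.
Proof.
move=> [cov sep] s.
have [i im e] := sqdist_min_attained hL t s m0.
have le_i k : (k < m)%N -> circ (s - t i) <= circ (s - t k).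
  move=> km; rewrite -(ler_pXn2r (n := 2)) ?nnegrE ?circle_dist_ge0// -e.
  exact: sqdist_min_le.
have ci : circ (s - t i) <= r.
  by have [k km] := cov s; apply: le_trans; exact: le_i.
rewrite e (bigD1 (Ordinal im))//= big1 => [|[k km]].
  by rewrite addr0 bump_near// subKr.
rewrite -val_eqE/= => ki.
rewrite bump_far// leNgt; apply: contra ki => ck; apply/eqP.
by apply: (sep s) => //; exact: le_lt_trans (le_i k km) ck.
Qed.

(* The point just beyond the end of the arc around t k is covered by another arc,
   whose centre can only be t k + 2 r. *)
Lemma tiling_succ : tiling L r m t ->
  forall k, (k < m)%N -> exists2 j, (j < m)%N & circ (t j - (t k + 2 * r)) = 0.
Proof.
move=> [cov sep] k km; set x := t k + 2 * r.
have [i im e] := sqdist_min_attained hL t x m0.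
have le_i j : (j < m)%N -> circ (x - t i) <= circ (x - t j).
  move=> jm; rewrite -(ler_pXn2r (n := 2)) ?nnegrE ?circle_dist_ge0// -e.
  exact: sqdist_min_le.
exists i => //; rewrite circle_distC//; apply/eqP; apply: contraT => d0.
set d := circ (x - t i) in d0 le_i.
have {}d0 : 0 < d by rewrite lt_neqAle eq_sym d0 circle_dist_ge0.
(* The overshoot is half the supposed distance [d] from [x] to the codebook; [b] is the lift of the
   covering codepoint near this point. *)
have [j jm] := cov (t k + r + d / 2).
have [z ->] := circle_dist_attained hL (t k + r + d / 2 - t j).
set b := t j + z%:~R * L => hb.
have {}hb : `|t k + r + d / 2 - b| <= r by rewrite /b opprD addrA.
have {}hb : b - t k >= d / 2 /\ b - t k <= 2 * r + d / 2.
  by move: hb; rewrite ler_norml => /andP[h1 h2]; split; lra.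
have cb y : circ (y - t j) <= `|y - b|.
  by rewrite /b opprD addrA; exact: circle_dist_le.
(* At or beyond [x], [b] would lie within [d / 2] of [x], nearer than the nearest codepoint. *)
have bx : b < x.
  rewrite ltNge; apply/negP => xb.
  have := le_trans (le_i j jm) (cb x); rewrite ler0_norm ?subr_le0//.
  by move: hb xb; rewrite /x => -[h1 h2] xb; lra.
(* As [b] is less than [2 r] beyond [t k], their midpoint lies in both open arcs. Hence [j = k], and
   [b - t k] is a multiple of [L] strictly between 0 and [L]. *)
pose p := (t k + b) / 2.
have ck : circ (p - t k) < r.
  apply: le_lt_trans (circle_dist_le_norm hL _) _.
  move: hb bx; rewrite /x /p => -[h1 h2] bx; rewrite ltr_norml.
  by apply/andP; split; lra.
have cj : circ (p - t j) < r.
  apply: le_lt_trans (cb p) _.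
  move: hb bx; rewrite /x /p => -[h1 h2] bx; rewrite ltr_norml.
  by apply/andP; split; lra.
have jk := sep p j k jm km cj ck.
have hz : b - t k = z%:~R * L by rewrite /b jk addrAC subrr add0r.
have : 0 < z%:~R * L < 1 * L.
  rewrite -hz mul1r; move: hb bx rL; rewrite /x => -[h1 h2] bx rL'.
  by apply/andP; split; lra.
rewrite pmulr_lgt0// ltr_pM2r// ltr0z ltrz1.
by case: z {b hb cb bx p ck cj jk hz} => // -[].
Qed.

End Core.

(** * Equidistant points tile the circle *)

Section Equidistant.
Variables (R : realType) (L s0 : R) (n : nat).
Hypotheses (hL : 0 < L) (n0 : (0 < n)%N).
Let r := L / n%:R / 2.
Local Notation circ := (circle_dist L).
Local Notation t := (fun k : nat => s0 + k%:R * (L / n%:R)).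

Let n0' : 0 < n%:R :> R. Proof. by rewrite ltr0n. Qed.

Let Ln0 : 0 < L / n%:R. Proof. exact: divr_gt0. Qed.

(** Modulo [L], the difference is [j - k - z n] steps of length [L / n]. An integer of absolute
    value below 1 is 0, and two indices below [n] that are congruent modulo [n] are equal. *)
Lemma equidistant_sep j k : (j < n)%N -> (k < n)%N ->
  circ (t j - t k) < L / n%:R -> j = k.
Proof.
move=> jn kn; have [z ->] := circle_dist_attained hL (t j - t k).
have -> : t j - t k - z%:~R * L = (j%:Z - k%:Z - z * n%:Z)%:~R * (L / n%:R).
  rewrite !intrB intrM; field; exact: lt0r_neq0.
rewrite normrM (gtr0_norm Ln0) gtr_pMl// -intr_norm -[1]/(1%:~R) ltr_int.
move=> h; have {}h : j%:Z - k%:Z = z * n%:Z by lia.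
have [z0|[z0|z0]] : z = 0 \/ z <= -1 \/ 1 <= z by lia.
- by move: h; rewrite z0; lia.
- nia.
- nia.
Qed.

Lemma equidistant_cover s : exists2 k, (k < n)%N & circ (s - t k) <= r.
Proof.
(* Adding half a step before the floor rounds to the nearest step; the remainder of [q] modulo [n]
   is the index and the quotient counts full turns. *)
pose q := Num.floor ((s - s0 + r) / (L / n%:R)).
have q1 : q%:~R * (L / n%:R) <= s - s0 + r.
  by rewrite -ler_pdivlMr//; exact: floor_le_tmp.
have q2 : s - s0 + r < (q + 1)%:~R * (L / n%:R).
  by rewrite -ltr_pdivrMr//; exact: floorD1_gt.
rewrite intrD mulrDl mul1r in q2.
have nZ : n%:Z != 0 by rewrite eqz_nat -lt0n.
have kn : (`|(q %% n)%Z| < n)%N.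
  by rewrite -ltz_nat gez0_abs ?modz_ge0// ltz_pmod.
exists `|(q %% n)%Z|%N => //.
apply: le_trans (circle_dist_le hL _ (q %/ n)%Z) _.
have -> : s - (s0 + `|(q %% n)%Z|%N%:R * (L / n%:R)) - ((q %/ n)%Z)%:~R * L =
    s - s0 - q%:~R * (L / n%:R).
  rewrite {3}(divz_eq q n) intrD intrM -[(`|_|%N)%:R]/((`|(q %% n)%Z|%N%:Z)%:~R).
  rewrite gez0_abs ?modz_ge0//; field; exact: lt0r_neq0.
by rewrite ler_norml; move: q1 q2; rewrite /r => q1 q2; apply/andP; split; lra.
Qed.

Lemma equidistant_tiling : tiling L r n t.
Proof.
split=> [s|s j k jn kn cj ck]; first exact: equidistant_cover.
apply: equidistant_sep => //.
apply: le_lt_trans (circle_dist_triangle hL s _ _) _.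
by rewrite [circ (_ - s)]circle_distC// [ltRHS]splitr ltrD.
Qed.

End Equidistant.

(** * Optimal sets of n-means *)

Section Optimal.
Variables (R : realType) (N : nat) (C : set 'rV[R]_N) (L : R).
Variables (gamma : R -> 'rV[R]_N).
Hypotheses (hL : 0 < L) (hg : unit_speed_loop C L gamma).
Variable n : nat.
Hypothesis n0 : (0 < n)%N.
Local Notation circ := (circle_dist L).
Local Notation geo := (geodesic_dist C).
Local Notation mu := (@lebesgue_measure R).
(** This radius maximizes the lower bound [L * r ^+ 2 - n%:R * (4 / 3 * r ^+ 3)] over positive
    [r]. *)
Let r := L / n%:R / 2.

Let n0' : 0 < n%:R :> R. Proof. by rewrite ltr0n. Qed.

Let r0 : 0 < r. Proof. by rewrite !divr_gt0. Qed.

Let rL : r <= L / 2.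
Proof.
rewrite ler_pM2r ?invr_gt0// ler_pdivrMr// ler_pMr//.
by rewrite -[1]/(1%:R) ler_nat.
Qed.

Let r2 : 2 * r = L / n%:R. Proof. by rewrite mulrC divfK. Qed.

Let rV : L * r ^+ 2 - n%:R * (4 / 3 * r ^+ 3) = L * (L ^+ 2 / (12 * n%:R ^+ 2)).
Proof. by rewrite /r; field; exact: lt0r_neq0. Qed.

Lemma loop_equidistant_inj s0 i j : (i < n)%N -> (j < n)%N ->
  gamma (s0 + i%:R * (L / n%:R)) = gamma (s0 + j%:R * (L / n%:R)) -> i = j.
Proof.
move=> hi hj /(loop_eqP hL hg) e; apply: (equidistant_sep hL n0 (s0 := s0)) => //.
by rewrite e divr_gt0.
Qed.

Lemma equidistant_card s0 :
  [set gamma (s0 + k%:R * (L / n%:R)) | k in `I_n] #= `I_n.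
Proof.
apply: inj_card_eq => i j; rewrite !inE /= => hi hj.
exact: loop_equidistant_inj.
Qed.

Lemma equidistant_codebook s0 :
  codebook C n [set gamma (s0 + k%:R * (L / n%:R)) | k in `I_n].
Proof.
split; first by move=> _ [k _ <-]; rewrite (usl_range hg); eexists.
exact: card_image_le.
Qed.

(** Iterating [tiling_succ] from [t 0] shows that all [n] equidistant points are codepoints. Their
    indices are distinct, and an injective self-map of ['I_n] is bijective, so no codepoint is
    missed. *)
Lemma tiling_equally_spaced (t : nat -> R) : tiling L r n t ->
  equally_spaced L gamma n [set gamma (t k) | k in `I_n].
Proof.
move=> tl.
have step k : exists j, (j < n)%N /\ gamma (t j) = gamma (t 0%N + k%:R * (L / n%:R)).
  elim: k => [|k [j [jn e]]]; first by exists 0%N; rewrite mul0r addr0.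
  have [i im ci] := tiling_succ hL rL n0 tl jn.
  exists i; split => //; rewrite -natr1 mulrDl mul1r addrA.
  move/(loop_eqP hL hg) : ci => ->; rewrite r2.
  apply/(loop_eqP hL hg); rewrite opprD addrACA subrr addr0.
  exact/(loop_eqP hL hg).
have /choice[f hf] := step.
have fn k : (f k < n)%N by have [] := hf k.
have finj : injective (fun i : 'I_n => Ordinal (fn i)).
  move=> i j [e]; apply: val_inj => /=.
  apply: (loop_equidistant_inj (s0 := t 0%N)) => //.
  by have [_ <-] := hf i; have [_ <-] := hf j; rewrite e.
have eE : [set gamma (t k) | k in `I_n] =
    [set gamma (t 0%N + k%:R * (L / n%:R)) | k in `I_n].
  apply/seteqP; split=> _ [k /= kn <-]; last first.
    by exists (f k) => //=; have [_ ->] := hf k.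
  have [g _ gK] := injF_bij finj.
  exists (g (Ordinal kn)); first exact: ltn_ord.
  have [_ <-] := hf (g (Ordinal kn)).
  by have /(congr1 val)/= -> := gK (Ordinal kn).
by rewrite /equally_spaced eE; split; [exact: equidistant_card|exists (t 0%N)].
Qed.

(** Some codepoint is within [r] of any point, so points of the region are within [r] of [c].
    Conversely, a codepoint strictly closer than [c] to a point of the arc would be less than
    [2 r = L / n] from [c]. *)
Lemma loop_voronoi s0 j : (j < n)%N ->
  voronoi_region C geo [set gamma (s0 + k%:R * (L / n%:R)) | k in `I_n]
    (gamma (s0 + j%:R * (L / n%:R))) =
  gamma @` `[s0 + j%:R * (L / n%:R) - r, s0 + j%:R * (L / n%:R) + r].
Proof.
move=> jn; have cov := equidistant_cover s0 hL n0.
have sep := equidistant_sep hL n0 (s0 := s0).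
set c := s0 + j%:R * _; apply/seteqP; split=> [x [Cx hx]|y [s /= hs <-]].
  move: Cx; rewrite [X in X x](usl_range hg) => -[s _ sx]; subst x.
  have [k kn ck] := cov s.
  have := hx (gamma (s0 + k%:R * (L / n%:R))) (ex_intro2 _ _ k kn erefl).
  rewrite !(geodesic_dist_loop hL hg) => hck.
  have : circ (s - c) <= r by exact: le_trans hck ck.
  have [z ->] := circle_dist_attained hL (s - c); rewrite ler_norml => /andP[h1 h2].
  exists (s - z%:~R * L).
    by rewrite /= in_itv/=; apply/andP; split; lra.
  by rewrite -mulNr -intrN (loopDz hg).
move: hs; rewrite in_itv/= => /andP[h1 h2]; split.
  by rewrite [X in X _](usl_range hg); exists s.
move=> _ [k /= kn <-]; rewrite !(geodesic_dist_loop hL hg) leNgt; apply/negP => h.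
have hc : circ (s - c) <= r.
  apply: le_trans (circle_dist_le_norm hL _) _.
  by rewrite ler_norml; apply/andP; split; lra.
have jk : j = k.
  apply: sep => //; rewrite -/c -[ltRHS]r2.
  apply: le_lt_trans (circle_dist_triangle hL s _ _) _.
  rewrite (circle_distC hL c s) [2 * r]mulr_natl mulr2n; apply: ler_ltD => //.
  exact: lt_le_trans h hc.
by move: h; rewrite /c jk ltxx.
Qed.

(** With [u] moved into [[0, L)], the parameters of the arc form [[u, v]] when [v < L]. Otherwise
    the arc wraps around, and they are all of [[0, L)] except the gap from [v - L] to [u]. *)
Lemma arc_length_arc u v : u <= v -> v - u <= L ->
  arc_length L gamma (gamma @` `[u, v]) = (v - u)%:E.
Proof.
wlog : u v / 0 <= u < L => [hw|/andP[u0 uL]] uv vuL.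
  have [k k0 kL] := floor_reduction u hL.
  have -> : gamma @` `[u, v] = gamma @` `[u - k%:~R * L, v - k%:~R * L].
    apply/seteqP; split=> y [s /=]; rewrite in_itv/= => /andP[s1 s2] <-.
      exists (s - k%:~R * L); last by rewrite -mulNr -intrN (loopDz hg).
      by rewrite /= in_itv/= !lerD2r s1.
    exists (s + k%:~R * L); last by rewrite (loopDz hg).
    by rewrite /= in_itv/=; apply/andP; split; lra.
  have e : v - k%:~R * L - (u - k%:~R * L) = v - u by ring.
  rewrite hw ?e//; first by rewrite k0.
  by rewrite lerD2r.
have hL' := hL.
have zero (z : int) : - L < z%:~R * L < L -> z = 0.
  move=> /andP[h3 h4].
  have h3' : ((-1)%:~R : R) * L < z%:~R * L by rewrite mulN1r.
  have h4' : z%:~R * L < (1%:~R : R) * L by rewrite mul1r.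
  by move: h3' h4'; rewrite !ltr_pM2r// !ltr_int; lia.
rewrite /arc_length; have [vL|Lv] := ltP v L.
  have -> : `[0, L[ `&` gamma @^-1` (gamma @` `[u, v]) = `[u, v]%classic.
    apply/seteqP; split=> s; rewrite /= !in_itv/=.
      move=> [/andP[s1 s2] [w]]; rewrite in_itv/= => /andP[w1 w2] /(usl_simple hg)[z hz].
      have : z = 0 by apply: zero; rewrite -hz; apply/andP; split; lra.
      by move=> z0; move: hz; rewrite z0 mul0r => hz; apply/andP; split; lra.
    move=> /andP[s1 s2]; split; first by apply/andP; split; lra.
    by exists s => //; rewrite in_itv/= s1.
  rewrite lebesgue_measure_itv/= lte_fin -EFinD; case: ltP => // vu.
  by congr EFin; lra.
have -> : `[0, L[ `&` gamma @^-1` (gamma @` `[u, v]) = `[0, L[ `\` `]v - L, u[.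
  apply/seteqP; split=> s; rewrite /= !in_itv/= => -[/andP[s1 s2]].
    move=> [w]; rewrite in_itv/= => /andP[w1 w2] /(usl_simple hg)[z hz].
    split; first by rewrite s1.
    move=> /andP[s3 s4].
    have : z - 1 = 0.
      by apply: zero; rewrite intrB mulrBl mul1r -hz; apply/andP; split; lra.
    move=> /(congr1 (fun z : int => z%:~R * L)); rewrite intrB mulrBl mul1r -hz mul0r.
    by lra.
  move=> /negP; rewrite negb_and -!leNgt => h; split; first by rewrite s1.
  have [us|su] := leP u s.
    by exists s => //; rewrite in_itv/=; apply/andP; split; lra.
  move: h; rewrite [u <= s]leNgt su orbF => h.
  exists (s + L); last exact: (usl_periodic hg).
  by rewrite in_itv/=; apply/andP; split; lra.
have fA : (mu `[0%R, L[%classic < +oo)%E.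
  by rewrite lebesgue_measure_itv/= lte_fin hL ltry.
rewrite measureD//.
rewrite setIidr; last first.
  move=> s; rewrite /= !in_itv/= => /andP[s1 s2].
  by apply/andP; split; lra.
have eA : mu `[0%R, L[%classic = L%:E.
  by rewrite lebesgue_measure_itv/= lte_fin hL -EFinD subr0.
have eB : mu `](v - L)%R, u[%classic = (u - (v - L))%:E.
  rewrite lebesgue_measure_itv/= lte_fin -EFinD; case: ltP => // h.
  by congr EFin; lra.
rewrite [X in (X - _)%E]eA [X in (_ - X)%E]eB -EFinB.
by congr EFin; ring.
Qed.

Lemma loop_voronoi_optimal (alpha : set 'rV[R]_N) (a : 'rV[R]_N) :
  equally_spaced L gamma n alpha -> alpha a ->
  arc_length L gamma (voronoi_region C geo alpha a) = (L / n%:R)%:E /\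
  geodesic_midpoint geo gamma (voronoi_region C geo alpha a) a.
Proof.
move=> [_ [s0 ->]] [j jn <-]; rewrite loop_voronoi//.
set c := s0 + _.
have e : c + r - (c - r) = 2 * r by ring.
have h1 : c - r <= c + r by move: r0; lra.
split.
  rewrite arc_length_arc ?e ?r2//.
  by rewrite -r2; move: rL; lra.
exists (c - r), (c + r); rewrite e; split => //.
- by congr gamma; lra.
- rewrite (geodesic_dist_loop hL hg) subKr circle_dist_small ?gtr0_norm//.
  by rewrite mulrC mulKr// unitfE.
- rewrite (geodesic_dist_loop hL hg) opprD addrA subrr add0r circle_distN//.
  by rewrite circle_dist_small ?gtr0_norm// mulrC mulKr// unitfE.
Qed.

Variable P : probability (borel_rV R N) R.
Hypothesis hP : uniform_on_curve hL gamma P.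

Lemma equidistant_distortion s0 :
  distortion P C geo [set gamma (s0 + k%:R * (L / n%:R)) | k in `I_n] =
  (L ^+ 2 / (12 * n%:R ^+ 2))%:E.
Proof.
pose t (k : nat) := s0 + k%:R * (L / n%:R).
rewrite (distortion_loop hg hP t n0).
rewrite integral_itvE; last exact: sqdist_min_continuous.
have tl : tiling L r n t by exact: equidistant_tiling.
have -> : \int[mu]_(s in `[0, L]) sqdist_min L n t s =
    L * (L ^+ 2 / (12 * n%:R ^+ 2)).
  rewrite -rV -(@Rintegral_bound R L r n t)//; apply: eq_Rintegral => s _.
  exact: tiling_tight.
by rewrite -EFinM mulKr// unitfE; exact: lt0r_neq0.
Qed.

Lemma distortion_lower_bound (alpha : set 'rV[R]_N) : codebook C n alpha ->
  ((L ^+ 2 / (12 * n%:R ^+ 2))%:E <= distortion P C geo alpha)%E /\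
  (distortion P C geo alpha = (L ^+ 2 / (12 * n%:R ^+ 2))%:E ->
   equally_spaced L gamma n alpha).
Proof.
move=> [aC an]; have fa : finite_set alpha := card_le_finite an (finite_II n).
have [m [t [ea am _]]] := finite_loop_subset hg aC fa.
have mn : (m <= n)%N by rewrite -card_le_II -(card_le_eql am).
(* The empty codebook is treated apart, since its distortion is infinite while [sqdist_min] has a
   finite default. *)
have [m0|m0] := posnP m.
  move: ea; rewrite m0 II0 image_set0 => ->.
  by rewrite (distortion_loop0 hg hP) leey.
rewrite ea (distortion_loop hg hP t m0) integral_itvE; last exact: sqdist_min_continuous.
set J := \int[mu]_(s in _) _.
have lb : L * r ^+ 2 - m%:R * (4 / 3 * r ^+ 3) <= J by exact: sqdist_min_lower_bound.
have c0 : 0 < 4 / 3 * r ^+ 3 by rewrite mulr_gt0// exprn_gt0.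
have Vinj x : (L^-1 * J = x) -> J = L * x.
  by move=> <-; rewrite mulVKr// unitfE; exact: lt0r_neq0.
split.
  rewrite -EFinM lee_fin [leRHS]mulrC ler_pdivlMr// [leLHS]mulrC -rV (le_trans _ lb)//.
  by rewrite lerD2l lerN2 ler_pM2r// ler_nat.
rewrite -EFinM => -[/Vinj eJ].
(* With [r] fixed by [n], the lower bound strictly decreases in [m], so fewer points cannot reach
   the value for [n]. *)
have e : m = n.
  apply/eqP; rewrite eqn_leq mn /= -(ler_nat R) -(ler_pM2r c0).
  by move: lb; rewrite eJ -rV lerD2l lerN2.
move: eJ; rewrite /J; subst m; rewrite -rV => eJ.
apply: tiling_equally_spaced; apply: (tight_tiling hL r0 n0) => //.
exact: sqdist_min_tight.
Qed.

Lemma loop_quantization_error :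
  quantization_error P C geo n = (L ^+ 2 / (12 * n%:R ^+ 2))%:E.
Proof.
apply/eqP; rewrite eq_le; apply/andP; split.
  rewrite -(equidistant_distortion 0); apply: ereal_inf_lbound.
  exists [set gamma (0 + k%:R * (L / n%:R)) | k in `I_n] => //.
  exact: equidistant_codebook.
by apply: le_ereal_inf_tmp => _ [alpha /distortion_lower_bound[h _] <-].
Qed.

Lemma loop_optimal_n_means (alpha : set 'rV[R]_N) :
  optimal_n_means P C geo n alpha <-> equally_spaced L gamma n alpha.
Proof.
rewrite /optimal_n_means loop_quantization_error; split.
  by move=> [/distortion_lower_bound[_ h]] /h.
move=> [_ [s0 ->]]; split; first exact: equidistant_codebook.
exact: equidistant_distortion.
Qed.

End Optimal.

(** * Transport between closed curves of equal length *)

Section Transport.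
Variables (R : realType) (N1 N2 : nat) (C1 : set 'rV[R]_N1) (C2 : set 'rV[R]_N2).
Variables (L : R) (g1 : R -> 'rV[R]_N1) (g2 : R -> 'rV[R]_N2).
Hypotheses (hL : 0 < L).
Hypotheses (h1 : unit_speed_loop C1 L g1) (h2 : unit_speed_loop C2 L g2).
Variables (P1 : probability (borel_rV R N1) R) (P2 : probability (borel_rV R N2) R).
Hypotheses (hP1 : uniform_on_curve hL g1 P1) (hP2 : uniform_on_curve hL g2 P2).

(** The map matches points with the same parameter. Any choice [theta] of parameters will do,
    because both curves identify exactly the parameters that agree modulo [L]. *)
Theorem loop_quantization_equivalent :
  quantization_equivalent P1 C1 (geodesic_dist C1) P2 C2 (geodesic_dist C2).
Proof.
have /choice[theta htheta] (x : 'rV[R]_N1) : exists s, C1 x -> g1 s = x.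
  have [C1x|nC] := pselect (C1 x); last by exists 0.
  by move: (C1x); rewrite [X in X x](usl_range h1) => -[s _ <-]; exists s.
pose phi (x : borel_rV R N1) : borel_rV R N2 := g2 (theta x).
have C1g s : C1 (g1 s) by rewrite (usl_range h1); exists s.
have C2g s : C2 (g2 s) by rewrite (usl_range h2); exists s.
have hphi s : phi (g1 s) = g2 s.
  by apply/(loop_eqP hL h2)/(loop_eqP hL h1); exact: htheta.
have isom x y : C1 x -> C1 y ->
    geodesic_dist C2 (phi x) (phi y) = geodesic_dist C1 x y.
  rewrite {1 2}(usl_range h1) => -[s _ <-] [u _ <-].
  by rewrite !hphi (geodesic_dist_loop hL h2) (geodesic_dist_loop hL h1).
have bij : set_bij C1 C2 phi.
  split.
  - by move=> x _; exact: C2g.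
  - move=> x y; rewrite !inE {1 2}(usl_range h1) => -[s _ <-] [u _ <-].
    by rewrite !hphi => /(loop_eqP hL h2)/(loop_eqP hL h1).
  - move=> y; rewrite [X in X y](usl_range h2) => -[s _ <-].
    by exists (g1 s); rewrite ?hphi.
have mphi : measurable_fun (C1 : set (borel_rV R N1)) phi.
  apply: (loop_measurable_fun_rV hL h1); rewrite (_ : phi \o g1 = g2).
    exact: (loop_continuous h2).
  exact/funext.
have dist_eq alpha : alpha `<=` C1 -> finite_set alpha ->
    distortion P2 C2 (geodesic_dist C2) (phi @` alpha) =
    distortion P1 C1 (geodesic_dist C1) alpha.
  move=> aC fa; have [m [t [-> _ _]]] := finite_loop_subset h1 aC fa.
  have -> : phi @` [set g1 (t k) | k in `I_m] = [set g2 (t k) | k in `I_m].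
    by rewrite image_comp; apply: eq_imagel => k _ /=; exact: hphi.
  have [->|m0] := posnP m.
    by rewrite II0 !image_set0 (distortion_loop0 h1 hP1) (distortion_loop0 h2 hP2).
  by rewrite (distortion_loop h1 hP1)// (distortion_loop h2 hP2).
have card_phi alpha : alpha `<=` C1 -> phi @` alpha #= alpha.
  move=> aC; apply: inj_card_eq => x y; rewrite !inE => ax ay.
  by have [_ inj _] := bij; apply: inj; rewrite inE; exact: aC.
have cb n alpha : alpha `<=` C1 ->
    codebook C2 n (phi @` alpha) <-> codebook C1 n alpha.
  move=> aC; have /card_eqPle[le1 le2] := card_phi alpha aC.
  split=> -[_ h]; split=> //; first exact: card_le_trans le2 h.
    by move=> _ [x _ <-]; exact: C2g.
  exact: card_le_trans le1 h.
have fin n alpha : codebook C1 n alpha -> finite_set alpha.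
  by move=> [_ h]; exact: card_le_finite h (finite_II n).
have err n : quantization_error P2 C2 (geodesic_dist C2) n =
    quantization_error P1 C1 (geodesic_dist C1) n.
  congr ereal_inf; apply/seteqP; split=> _ [alpha ca <-].
    (* Every codebook of the second curve is the image of one of the first, so both infima range
       over the same values. *)
    pose beta := C1 `&` phi @^-1` alpha.
    have bC : beta `<=` C1 by exact: subIsetl.
    have eb : phi @` beta = alpha.
      apply/seteqP; split=> [_ [x [_ ?] <-]//|y ay].
      have := ca.1 y ay; rewrite [X in X y](usl_range h2) => -[s _ sy].
      by exists (g1 s); rewrite ?hphi//; split => //=; rewrite hphi sy.
    have cbeta : codebook C1 n beta by apply/cb => //; rewrite eb.
    by exists beta => //; rewrite -dist_eq ?eb//; exact: fin cbeta.
  exists (phi @` alpha); first by apply/cb => //; case: ca.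
  by rewrite dist_eq//; [case: ca|exact: fin ca].
exists phi; split => //.
- split => // B mB; rewrite hP2// hP1; last exact: mphi (loop_measurable hL h1) _ mB.
  rewrite /pushforward; congr (uniform_prob hL _).
  apply/seteqP; split=> s /=; first by move=> Bs; split; rewrite ?hphi.
  by move=> [_]; rewrite hphi.
- move=> n; split=> // alpha aC; rewrite /optimal_n_means err cb//.
  by split => -[ca e]; split => //; rewrite -?e ?dist_eq//; exact: fin ca.
Qed.

End Transport.
Theorem theorem1p1 (R : realType) (rho L : R) (hrho : 0 < rho) (hL : 0 < L)
    (C : set 'rV[R]_3) (hC : C `<=` esphere rho)
    (gamma : R -> 'rV[R]_3) (hgamma : arclength_param C L gamma)
    (P : probability (borel_rV R 3) R) (hP : uniform_on_curve hL gamma P) :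
  (forall Q : probability (borel_rV R 2) R,
     uniform_on_curve hL (round_circle_param L) Q ->
     quantization_equivalent P C (geodesic_dist C)
       Q (round_circle L) (geodesic_dist (round_circle L))) /\
  (forall n : nat, (1 <= n)%N ->
     [/\ (forall alpha : set 'rV[R]_3,
            optimal_n_means P C (geodesic_dist C) n alpha <->
            equally_spaced L gamma n alpha),
         (forall alpha : set 'rV[R]_3,
            optimal_n_means P C (geodesic_dist C) n alpha ->
            forall a : 'rV[R]_3, alpha a ->
              arc_length L gamma
                (voronoi_region C (geodesic_dist C) alpha a)
              = (L / n%:R)%:E /\
              geodesic_midpoint (geodesic_dist C) gamma
                (voronoi_region C (geodesic_dist C) alpha a) a) &
         quantization_error P C (geodesic_dist C) n
         = (L ^+ 2 / (12 * n%:R ^+ 2))%:E]).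

Proof.
have hg := arclength_param_loop hgamma.
split=> [Q hQ|n n0].
  (* The round circle is itself a unit-speed loop of length [L]. *)
  exact: (loop_quantization_equivalent hg (round_circle_loop hL) hP hQ).
split.
- by move=> alpha; exact: (loop_optimal_n_means hg n0 hP).
- move=> alpha /(loop_optimal_n_means hg n0 hP) ha a aa.
  exact: (loop_voronoi_optimal hL hg n0 ha aa).
- exact: (loop_quantization_error hg n0 hP).
Qed.
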